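(* Let $\mathcal F$ be a germ of saddle-node foliation at the origin of $\mathbb R^2$ (resp. of $\mathbb C^2$) having formal invariants $k=1$ and $\mu$ arbitrary. Then there exist local analytic coordinates (real analytic, resp. complex analytic) at the origin in which $\mathcal F$ is defined by a vector field of the form $$X_f=x^2\partial_x+y\partial_y+xf(y)\partial_y,$$ where $f\in\mathbb R\{y\}$ (resp. $f\in\mathbb C\{y\}$) is a convergent power series with $f'(0)=\mu$.
   Context: $\mathbb C\{\cdot\}$ and $\mathbb R\{\cdot\}$ denote rings of convergent power series with complex, resp. real, coefficients. A germ of singular foliation $\mathcal F$ at the origin of $\mathbb C^2$ (resp. $\mathbb R^2$) is the foliation induced by the (complex) integral curves of a germ of analytic vector field $X=a(x,y)\partial_x+b(x,y)\partial_y$ with complex (resp. real) convergent coefficients and $a(0)=b(0)=0$. Two such vector fields define the same foliation when they differ by multiplication by a non-vanishing analytic germ. $\mathcal F$ is a saddle-node if, in suitable analytic coordinates, it is defined by a vector field with an isolated singularity at $0$ of the form $X=y\partial_y+(\text{higher order terms})$. Formal invariants: by a theorem of Dulac, for every saddle-node foliation there are a unique integer $k\ge 1$ and a unique scalar $\mu\in\mathbb C$ such that, for arbitrarily large $N\in\mathbb N$, there are analytic coordinates in which the foliation is defined by a vector field of the form $$x^{k+1}\partial_x+y\partial_y+\mu x^ky\,\partial_y+x^{k+N}h(x,y)\partial_y,\qquad h\in\mathbb C\{x,y\}.$$ The pair $(k,\mu)$ is called the formal invariants of the saddle-node. *)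

(* Defs.v *)
From mathcomp Require Import all_boot all_order all_algebra.
From mathcomp Require Import all_classical all_reals all_analysis.
From mathcomp Require Import complex.

Set Implicit Arguments.
Unset Strict Implicit.
Unset Printing Implicit Defensive.

Import Order.TTheory GRing.Theory Num.Theory.
Import numFieldNormedType.Exports.

Local Open Scope classical_set_scope.
Local Open Scope ring_scope.

(** A power series is its coefficient family: [a i j] is the coefficient of
    [x ^ i * y ^ j].  The ring product is [smul], not the pointwise product
    that function types carry in MathComp-Analysis. *)
Definition series1 (K : numFieldType) : Type := nat -> K.
Definition series2 (K : numFieldType) : Type := nat -> nat -> K.

Section Series.
Variable K : numFieldType.
Implicit Types (a b p q : series2 K) (f : series1 K).

(** [f \in K{y}]: absolute convergence at some positive radius. *)
Definition convergent1 f : Prop :=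
  exists2 r : K, 0 < r & cvgn (series (fun n => `|f n| * r ^+ n)).

(** [a \in K{x, y}]: absolute convergence on some bidisc; terms are grouped by
    total degree, which is harmless for nonnegative terms. *)
Definition convergent2 a : Prop :=
  exists2 r : K, 0 < r &
    cvgn (series (fun n => \sum_(i < n.+1) `|a i (n - i)%N| * r ^+ n)).

Definition evaluates_to a (x y v : K) : Prop :=
  series (fun n => \sum_(i < n.+1) a i (n - i)%N * x ^+ i * y ^+ (n - i))
    @ \oo --> v.

Definition smono (c : K) (m n : nat) : series2 K :=
  fun i j => if (i == m) && (j == n) then c else 0.

(** [f(y)] as a series in [x] and [y]. *)
Definition sliftY f : series2 K := fun i j => if i == 0%N then f j else 0.

Definition sadd a b : series2 K := fun i j => a i j + b i j.

Definition smul a b : series2 K := fun i j =>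
  \sum_(m < i.+1) \sum_(n < j.+1) a m n * b (i - m)%N (j - n)%N.

Definition sexp a (n : nat) : series2 K := iter n (smul a) (smono 1 0 0).

(** [a(p, q)], meaningful when [p] and [q] have no constant term: then
    [p ^ m * q ^ n] has order at least [m + n], so only [m, n <= i + j]
    contribute to the coefficient of [x ^ i * y ^ j]. *)
Definition scomp a p q : series2 K := fun i j =>
  \sum_(m < (i + j).+1) \sum_(n < (i + j).+1)
    a m n * smul (sexp p m) (sexp q n) i j.

Definition sderivX a : series2 K := fun i j => a i.+1 j *+ i.+1.
Definition sderivY a : series2 K := fun i j => a i j.+1 *+ j.+1.
Definition sderiv1 f : series1 K := fun n => f n.+1 *+ n.+1.

End Series.

(** [VField a b] is [a d/dx + b d/dy]. *)
Record vfield (K : numFieldType) : Type :=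
  VField { vfX : series2 K ; vfY : series2 K }.

Section Foliations.
Variable K : numFieldType.
Implicit Types (X Y : vfield K) (p q u : series2 K) (f : series1 K).

(** Vector fields defining a germ of singular foliation at the origin. *)
Definition singular_germ X : Prop :=
  [/\ convergent2 (vfX X), convergent2 (vfY X),
      vfX X 0%N 0%N = 0 & vfY X 0%N 0%N = 0].

(** [X(p)], the derivative of [p] along [X]. *)
Definition lie X p : series2 K :=
  sadd (smul (vfX X) (sderivX p)) (smul (vfY X) (sderivY p)).

Definition coordinates p q : Prop :=
  [/\ convergent2 p, convergent2 q, p 0%N 0%N = 0, q 0%N 0%N = 0 &
      p 1%N 0%N * q 0%N 1%N - p 0%N 1%N * q 1%N 0%N != 0].

Definition nonvanishing u : Prop := convergent2 u /\ u 0%N 0%N != 0.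

(** In suitable analytic coordinates [(p, q)], the foliation of [X] is defined
    by [Y]: the differential of [(p, q)] sends [X] to [u * (Y \o (p, q))] for
    some nonvanishing [u]. *)
Definition conjugate_to X Y : Prop :=
  exists p q u, [/\ coordinates p q, nonvanishing u,
    lie X p =2 smul u (scomp (vfX Y) p q) &
    lie X q =2 smul u (scomp (vfY Y) p q)].

Definition isolated_singularity X : Prop :=
  exists2 r : K, 0 < r & forall x y : K, `|x| < r -> `|y| < r ->
    evaluates_to (vfX X) x y 0 -> evaluates_to (vfY X) x y 0 ->
    x = 0 /\ y = 0.

(** [X] agrees with [y d/dy] up to terms of total degree at least 2. *)
Definition saddle_node_jet X : Prop :=
  forall i j, (i + j <= 1)%N ->
    vfX X i j = 0 /\ vfY X i j = smono 1 0 1 i j.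

Definition saddle_node X : Prop :=
  exists Y, [/\ singular_germ Y, isolated_singularity Y, saddle_node_jet Y &
    conjugate_to X Y].

(** [x^(k+1) d/dx + (y + mu x^k y + x^(k+N) h) d/dy] *)
Definition dulac_form (k : nat) (mu : K) (N : nat) (h : series2 K) : vfield K :=
  VField (smono 1 k.+1 0)
    (sadd (sadd (smono 1 0 1) (smono mu k 1)) (smul (smono 1 (k + N) 0) h)).

Definition formal_invariants X (k : nat) (mu : K) : Prop :=
  (1 <= k)%N /\
  forall N0 : nat, exists (N : nat) (h : series2 K),
    [/\ (N0 <= N)%N, convergent2 h & conjugate_to X (dulac_form k mu N h)].

(** [x^2 d/dx + (y + x f(y)) d/dy] *)
Definition prepared_form f : vfield K :=
  VField (smono 1 2 0) (sadd (smono 1 0 1) (smul (smono 1 1 0) (sliftY f))).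

End Foliations.

(** A foliation of the real plane is the one induced by the complex integral
    curves of a real vector field; its formal invariants, with [mu] and [h]
    complex, are those of the complexified vector field. *)
Definition complexify (R : realType) (X : vfield R) : vfield R[i] :=
  VField (fun i j => (vfX X i j)%:C%C) (fun i j => (vfY X i j)%:C%C).

(* Main.v *)
Require Import Defs.
From HB Require Import structures.
From mathcomp Require Import all_boot all_order all_algebra.
From mathcomp Require Import all_classical all_reals all_analysis.
From mathcomp Require Import complex.
From mathcomp Require Import ring lra zify.
Set Implicit Arguments.
Unset Strict Implicit.
Unset Printing Implicit Defensive.
Import Order.TTheory GRing.Theory Num.Theory.
Import numFieldNormedType.Exports.
Local Open Scope ring_scope.

(** After straightening the strong separatrix, a saddle-node with [k = 1] is
    [X = x^2 d/dx + b(x, y) d/dy], and a shear [y + x] makes [b_x(0, 0) <> 0]: then [X]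
    is transverse to [y = 0] away from the origin.  Following its leaves from the point
    [(x, y)] down to [(t, 0)] gives a first integral [t] on an annulus in [x].  For each
    fixed [y] the near-identity map from [x] to [t] is written as a conformal welding:
    [x = xi * (1 + v)] with [v] holomorphic near [xi = 0], and [t = xi * (1 + tau)] with
    [tau] holomorphic near [xi = oo].  In the coordinates [(xi, y)] the foliation is
    [xi^2 d/dxi + B(xi, y) d/dy], where [B] is holomorphic near [xi = 0] and, being
    computed from [t], grows at most linearly at infinity, so that
    [B = b0(y) + xi * b1(y)]; it remains to linearize [b0(y) d/dy].

    In the blown-up variables [X = xi], [Y = y / xi] no Laurent series are needed: [t] and
    [x] are power series, and [v] (resp. [tau]) collects the monomials [X^i Y^j] with
    [i > j] (resp. [i <= j]).  The welding is then a contraction for the total degree, and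
    its convergence follows from norm estimates uniform in the truncation degree. *)

(** The role of the shear is seen in the slope [z = y / x]: there the field becomes
    [x^2 d/dx + be(x, z) d/dz] with [be(0, 0) = b_x(0, 0)], which is regular once this number is
    nonzero, so that an ordinary flow box supplies the first integral. Over the complex numbers
    Dulac's coordinates already give the first component [x^2]. Over the reals they are only complex
    coordinates for the complexified field, and a real equation of the strong separatrix must be
    manufactured before the argument can start. Since the argument itself is needed over both
    fields, it is carried out over an abstract field with a real-valued absolute value. The number
    [mu] is not followed through the construction. It is recovered at the end from coefficients of
    order at most three in the equations of a conjugacy between a Dulac form and the prepared form;
    the same comparison provides the nonzero eigenvalue in the real case. *)

(** [series2 K] unfolds to a function type, which already carries the pointwise
    product; the alias keeps the two ring structures apart. *)
Definition fps (K : numFieldType) : Type := series2 K.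

(** * The ring of power series *)

Section PowerSeriesRing.
Variable K : numFieldType.
Implicit Types (a b : fps K) (c : K).

Lemma fps_ext a b : (forall i j, a i j = b i j) -> a = b.
Proof. by move=> E; apply: funext => i; apply: funext => j. Qed.

HB.instance Definition _ := gen_eqMixin (fps K).
HB.instance Definition _ := gen_choiceMixin (fps K).

Definition fzero : fps K := fun _ _ => 0.
Definition fopp a : fps K := fun i j => - a i j.
Definition fadd a b : fps K := sadd a b.
Definition fmul a b : fps K := smul a b.
Definition fcst (c : K) : fps K := smono c 0 0.

Lemma faddA : associative fadd.
Proof. by move=> a b c; apply: fps_ext => i j; apply: addrA. Qed.
Lemma faddC : commutative fadd.
Proof. by move=> a b; apply: fps_ext => i j; apply: addrC. Qed.
Lemma fadd0 : left_id fzero fadd.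
Proof. by move=> a; apply: fps_ext => i j; apply: add0r. Qed.
Lemma faddN : left_inverse fzero fopp fadd.
Proof. by move=> a; apply: fps_ext => i j; apply: addNr. Qed.

HB.instance Definition _ := GRing.isZmodule.Build (fps K) faddA faddC fadd0 faddN.

(** Commutativity and associativity of the Cauchy product are borrowed from iterated polynomials: on
    a box of exponents the product depends on nothing outside that box. *)
Definition trunc_poly (N : nat) a : {poly {poly K}} :=
  \poly_(i < N) \poly_(j < N) a i j.

Definition agree (N : nat) a (P : {poly {poly K}}) :=
  forall i j, (i < N)%N -> (j < N)%N -> a i j = P`_i`_j.

Lemma agree_trunc N a : agree N a (trunc_poly N a).
Proof. by move=> i j Hi Hj; rewrite !coef_poly Hi coef_poly Hj. Qed.

Lemma agree_mul N a b P Q : agree N a P -> agree N b Q -> agree N (fmul a b) (P * Q).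
Proof.
move=> HP HQ i j Hi Hj; rewrite /fmul /smul coefM coef_sum; apply: eq_bigr => m _.
rewrite coefM; apply: eq_bigr => n _; rewrite HP ?HQ //.
- exact: leq_ltn_trans (leq_subr _ _) Hi.
- exact: leq_ltn_trans (leq_subr _ _) Hj.
- by apply: leq_ltn_trans Hi; rewrite -ltnS.
- by apply: leq_ltn_trans Hj; rewrite -ltnS.
Qed.

Lemma agree_eq a b : (forall N, exists P, agree N a P /\ agree N b P) -> a = b.
Proof.
move=> H; apply: fps_ext => i j; have [P [Ha Hb]] := H (i + j).+1.
by rewrite Ha ?Hb // ltnS ?leq_addr ?leq_addl.
Qed.

Lemma fmulC : commutative fmul.
Proof.
move=> a b; apply: agree_eq => N; exists (trunc_poly N a * trunc_poly N b); split.
  by apply: agree_mul; apply: agree_trunc.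
by rewrite mulrC; apply: agree_mul; apply: agree_trunc.
Qed.

Lemma fmulA : associative fmul.
Proof.
move=> a b c; apply: agree_eq => N.
exists (trunc_poly N a * (trunc_poly N b * trunc_poly N c)); split.
  by do 2?apply: agree_mul; apply: agree_trunc.
by rewrite mulrA; do 2?apply: agree_mul; apply: agree_trunc.
Qed.

Lemma fmulDl : left_distributive fmul fadd.
Proof.
move=> a b c; apply: fps_ext => i j; rewrite /fmul /smul /fadd /sadd -big_split /=.
apply: eq_bigr => m _; rewrite -big_split; apply: eq_bigr => n _ /=; exact: mulrDl.
Qed.

Lemma fcstME c a i j : (fmul (fcst c) a) i j = c * a i j.
Proof.
rewrite /fmul /smul (bigD1 ord0) //= (bigD1 ord0) //= /fcst /smono !subn0 /=.
rewrite !big1 ?addr0 // => m.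
  by case: m => -[|m] Hm //= _; rewrite big1 // => n _; rewrite mul0r.
by case: m => -[|m] Hm //= _; rewrite mul0r.
Qed.

Lemma fmul1 : left_id (fcst 1) fmul.
Proof. by move=> a; apply: fps_ext => i j; rewrite fcstME mul1r. Qed.

Lemma fcst1_neq0 : fcst 1 != 0.
Proof.
apply/eqP => /(congr1 (fun a : fps K => a 0%N 0%N)) /eqP.
by rewrite /fcst /smono /= oner_eq0.
Qed.

HB.instance Definition _ :=
  GRing.Zmodule_isComNzRing.Build (fps K) fmulA fmulC fmul1 fmulDl fcst1_neq0.

Lemma coefDf a b i j : (a + b) i j = a i j + b i j. Proof. by []. Qed.
Lemma coefNf a i j : (- a) i j = - a i j. Proof. by []. Qed.
Lemma coefBf a b i j : (a - b) i j = a i j - b i j. Proof. by []. Qed.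
Lemma coef0f i j : (0 : fps K) i j = 0. Proof. by []. Qed.
Lemma coef1f i j : (1 : fps K) i j = ((i == 0%N) && (j == 0%N))%:R.
Proof. by rewrite /GRing.one /= /fcst /smono; case: ifP. Qed.
Lemma coefMf a b i j : (a * b) i j =
  \sum_(m < i.+1) \sum_(n < j.+1) a m n * b (i - m)%N (j - n)%N.
Proof. by []. Qed.
Lemma coefCf c i j : fcst c i j = if (i == 0%N) && (j == 0%N) then c else 0.
Proof. by []. Qed.
Lemma coefCM c a i j : (fcst c * a) i j = c * a i j.
Proof. exact: fcstME. Qed.
Lemma coef_sumf I (r : seq I) (P : pred I) (F : I -> fps K) i j :
  (\sum_(k <- r | P k) F k) i j = \sum_(k <- r | P k) F k i j.
Proof. by elim/big_rec2: _ => // k x y _ <-. Qed.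

Definition fX : fps K := smono 1 1 0.
Definition fY : fps K := smono 1 0 1.

Lemma coefXM a i j : (fX * a) i j = if i is i'.+1 then a i' j else 0.
Proof.
rewrite coefMf; case: i => [|i].
  by rewrite big1 // => m _; rewrite big1 // => n _; rewrite /fX /smono ord1 mul0r.
rewrite (bigD1 (Ordinal (isT : (1 < i.+2)%N))) //= (bigD1 ord0) //=.
rewrite /fX /smono /= mul1r subSS !subn0 !big1 ?addr0 //.
- move=> -[[|[|m]] Hm] //= _; rewrite big1 // => n _; by rewrite mul0r.
- by move=> -[[|n] Hn] //= _; rewrite mul0r.
Qed.

Lemma coefYM a i j : (fY * a) i j = if j is j'.+1 then a i j' else 0.
Proof.
rewrite coefMf (bigD1 ord0) //= [X in _ + X]big1 ?addr0; last first.
  by move=> -[[|m] Hm] //= _; rewrite big1 // => n _; rewrite /fY /smono mul0r.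
case: j => [|j].
  by rewrite big1 // => n _; rewrite /fY /smono ord1 mul0r.
rewrite (bigD1 (Ordinal (isT : (1 < j.+2)%N))) //=.
rewrite /fY /smono /= mul1r subSS !subn0 !big1 ?addr0 //.
by move=> -[[|[|n]] Hn] //= _; rewrite mul0r.
Qed.

Lemma fX_inj a b : fX * a = fX * b -> a = b.
Proof.
move=> E; apply: fps_ext => i j; move/(congr1 (fun a : fps K => a i.+1 j)): E.
by rewrite !coefXM.
Qed.

Lemma coefXE i j : fX i j = ((i == 1%N) && (j == 0%N))%:R.
Proof. by rewrite /fX /smono; case: ifP. Qed.
Lemma coefYE i j : fY i j = ((i == 0%N) && (j == 1%N))%:R.
Proof. by rewrite /fY /smono; case: ifP. Qed.

Lemma fcst0 : fcst 0 = 0.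
Proof. by apply: fps_ext => i j; rewrite coefCf coef0f; case: ifP. Qed.
Lemma fcst1 : fcst 1 = 1. Proof. by []. Qed.
Lemma fcstD x y : fcst (x + y) = fcst x + fcst y.
Proof. by apply: fps_ext => i j; rewrite coefDf !coefCf; case: ifP; rewrite ?addr0. Qed.
Lemma fcstN x : fcst (- x) = - fcst x.
Proof. by apply: fps_ext => i j; rewrite coefNf !coefCf; case: ifP; rewrite ?oppr0. Qed.
Lemma fcstM x y : fcst (x * y) = fcst x * fcst y.
Proof. by apply: fps_ext => i j; rewrite coefCM !coefCf; case: ifP; rewrite ?mulr0. Qed.

Definition shX a : fps K := fun i j => a i.+1 j.
Definition shY a : fps K := fun i j => a i j.+1.
(** Keeping only the row [i = 0] makes [fps_split] a disjoint decomposition: the monomials divisible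
    by [x] already belong to the [shX] term. *)
Definition shY0 a : fps K := fun i j => if i == 0%N then a i j.+1 else 0.

Lemma fps_split a : a = fcst (a 0%N 0%N) + fX * shX a + fY * shY0 a.
Proof.
apply: fps_ext => i j; rewrite !coefDf coefXM coefYM coefCf /shX /shY0.
by case: i => [|i]; case: j => [|j] //=; rewrite ?addr0 ?add0r.
Qed.

(** Congruence modulo the [d]-th power of the maximal ideal. It stands in for the adic topology:
    density, continuity and contraction are expressed degree by degree. *)
Definition eqd (d : nat) a b := forall i j, (i + j < d)%N -> a i j = b i j.

Lemma eqd_refl d a : eqd d a a. Proof. by []. Qed.
Lemma eqd_sym d a b : eqd d a b -> eqd d b a.
Proof. by move=> H i j L; rewrite H. Qed.
Lemma eqd_trans d b a (c : fps K) : eqd d a b -> eqd d b c -> eqd d a c.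
Proof. by move=> H1 H2 i j L; rewrite H1 // H2. Qed.
Lemma eqd_leq d e a b : (d <= e)%N -> eqd e a b -> eqd d a b.
Proof. by move=> L H i j L'; rewrite H // (leq_trans L'). Qed.
Lemma eqd_eq a b : (forall d, eqd d a b) -> a = b.
Proof. by move=> H; apply: fps_ext => i j; apply: (H (i + j).+1). Qed.
Lemma eqdD d a a' b b' : eqd d a a' -> eqd d b b' -> eqd d (a + b) (a' + b').
Proof. by move=> H1 H2 i j L; rewrite !coefDf H1 ?H2. Qed.
Lemma eqdN d a a' : eqd d a a' -> eqd d (- a) (- a').
Proof. by move=> H1 i j L; rewrite !coefNf H1. Qed.
Lemma eqdB d a a' b b' : eqd d a a' -> eqd d b b' -> eqd d (a - b) (a' - b').
Proof. by move=> H1 H2; apply: eqdD => //; apply: eqdN. Qed.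
Lemma eqdM d a a' b b' : eqd d a a' -> eqd d b b' -> eqd d (a * b) (a' * b').
Proof.
move=> H1 H2 i j L; rewrite !coefMf; apply: eq_bigr => m _; apply: eq_bigr => n _.
by move: (ltn_ord m) (ltn_ord n) => Hm Hn; rewrite H1 ?H2 //; lia.
Qed.
Lemma eqdX d a a' n : eqd d a a' -> eqd d (a ^+ n) (a' ^+ n).
Proof. by move=> H; elim: n => // n IH; rewrite !exprS; apply: eqdM. Qed.
Lemma eqd_sum d I (r : seq I) (P : pred I) (F G : I -> fps K) :
  (forall k, P k -> eqd d (F k) (G k)) ->
  eqd d (\sum_(k <- r | P k) F k) (\sum_(k <- r | P k) G k).
Proof. by move=> H; elim/big_rec2: _ => // k x y Pk E; apply: eqdD => //; apply: H. Qed.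
Lemma eqdBr d a b : eqd d a b <-> eqd d (a - b) 0.
Proof.
split=> H i j L; first by rewrite coefBf H // subrr.
by apply/eqP; rewrite -subr_eq0 -coefBf H.
Qed.

Lemma eqd_M0 d e a b : eqd d a 0 -> eqd e b 0 -> eqd (d + e) (a * b) 0.
Proof.
move=> H1 H2 i j L; rewrite coefMf big1 // => m _; rewrite big1 // => n _.
have [L1|L1] := ltnP (m + n) d; first by rewrite H1 // mul0r.
have [L2|L2] := ltnP ((i - m) + (j - n)) e; first by rewrite H2 // mulr0.
by have := ltn_ord m; have := ltn_ord n; lia.
Qed.

Lemma eqd_X0 a n : a 0%N 0%N = 0 -> eqd n (a ^+ n) 0.
Proof.
move=> H; elim: n => [|n IH] //; rewrite exprS -add1n; apply: eqd_M0 => //.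
by move=> [|i] [|j].
Qed.

Lemma eqd1P a : a 0%N 0%N = 0 <-> eqd 1 a 0.
Proof. by split=> [H [|i] [|j]//|->]. Qed.

Lemma eqd1M d a b b' : a 0%N 0%N = 0 -> eqd d b b' -> eqd d.+1 (a * b) (a * b').
Proof.
move=> /eqd1P H1 /eqdBr H2; apply/eqdBr; rewrite -mulrBr.
by rewrite -add1n; apply: eqd_M0.
Qed.

Lemma coef00M a b : (a * b) 0%N 0%N = a 0%N 0%N * b 0%N 0%N.
Proof. by rewrite coefMf !big_ord1. Qed.
Lemma coef00X a n : (a ^+ n) 0%N 0%N = a 0%N 0%N ^+ n.
Proof. by elim: n => [|n IH]; rewrite ?coef1f // !exprS coef00M IH. Qed.

Lemma coefXnM n a i j : (fX ^+ n * a) i j = if (n <= i)%N then a (i - n)%N j else 0.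
Proof.
elim: n i => [|n IH] i; first by rewrite expr0 mul1r subn0.
by rewrite exprS -mulrA coefXM; case: i => [|i] //; rewrite IH.
Qed.
Lemma coefYnM n a i j : (fY ^+ n * a) i j = if (n <= j)%N then a i (j - n)%N else 0.
Proof.
elim: n j => [|n IH] j; first by rewrite expr0 mul1r subn0.
by rewrite exprS -mulrA coefYM; case: j => [|j] //; rewrite IH.
Qed.

Definition trd (d : nat) a : fps K :=
  \sum_(n < d) \sum_(i < n.+1) fcst (a i (n - i)%N) * (fX ^+ i * fY ^+ (n - i)).

Lemma coef_monof c m n i j :
  (fcst c * (fX ^+ m * fY ^+ n)) i j = if (i == m) && (j == n) then c else 0.
Proof.
rewrite coefCM coefXnM -[fY ^+ n]mulr1.
have [L|L] := leqP m i; last first.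
  by rewrite mulr0; case: eqP => // E; move: L; rewrite E ltnn.
rewrite coefYnM coef1f; have [L'|L'] := leqP n j; last first.
  by rewrite mulr0 andbC; case: eqP => // E; move: L'; rewrite E ltnn.
rewrite !subn_eq0 (eqn_leq i) L andbT (eqn_leq j) L' andbT.
by case: ifP; rewrite ?mulr1 ?mulr0.
Qed.

Lemma smonoE c m n : (smono c m n : fps K) = fcst c * (fX ^+ m * fY ^+ n).
Proof. by apply: fps_ext => i j; rewrite coef_monof. Qed.

Lemma trdE d a i j : trd d a i j = if (i + j < d)%N then a i j else 0.
Proof.
rewrite /trd coef_sumf.
under eq_bigr do rewrite coef_sumf.
under eq_bigr do under eq_bigr do rewrite coef_monof.
case: ifP => L.
  rewrite (bigD1 (Ordinal L)) //= (bigD1 (inord i)) //= inordK; last by rewrite ltnS leq_addr.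
  rewrite eqxx addKn eqxx /= !big1 ?addr0 // => k Hk.
    rewrite big1 // => m _; case: ifP => // /andP[/eqP E1 /eqP E2]; case/eqP: Hk.
    by apply: val_inj => /=; have := ltn_ord m; lia.
  case: ifP => // /andP[/eqP E1 /eqP E2]; case/eqP: Hk.
  by apply: val_inj => /=; rewrite inordK ?ltnS ?leq_addr.
rewrite big1 // => k _; rewrite big1 // => m _; case: ifP => // /andP[/eqP E1 /eqP E2].
by have := ltn_ord k; have := ltn_ord m; lia.
Qed.

Lemma eqd_trd d a : eqd d a (trd d a).
Proof. by move=> i j L; rewrite trdE L. Qed.

(** Induction for formal identities: constants, sums and multiplication by the variables reach every
    polynomial, and the last hypothesis is closedness in the adic topology. *)
Lemma fps_dense (P : fps K -> Prop) :
  (forall c, P (fcst c)) -> (forall a b, P a -> P b -> P (a + b)) ->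
  (forall a, P a -> P (fX * a)) -> (forall a, P a -> P (fY * a)) ->
  (forall a, (forall d, exists2 a', P a' & eqd d a a') -> P a) -> forall a, P a.
Proof.
move=> Pc PD PX PY Pcl a; apply: Pcl => d; exists (trd d a); last exact: eqd_trd.
have P0 : P 0 by rewrite -fcst0.
rewrite /trd; elim/big_rec: _ => // k x _ Px; apply: (PD) => //.
elim/big_rec: _ => // i y _ Py; apply: PD => //.
move: (k - i)%N => l; move: (a i l) => c.
rewrite mulrCA; elim: (nat_of_ord i) => [|m IH]; last by rewrite exprS -mulrA; apply: PX.
rewrite mul1r mulrC; elim: l => [|m IH]; first by rewrite mul1r.
by rewrite exprS -mulrA; apply: PY.
Qed.

(** By continuity, an identity between additive operators only has to survive multiplication by [x]
    and by [y]. The loss [e] of degrees is 1 when a derivative occurs and 0 for products and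
    compositions. *)
Lemma fps_operator_eq (e : nat) (f g : fps K -> fps K) :
  (forall a b, f (a + b) = f a + f b) -> (forall a b, g (a + b) = g a + g b) ->
  (forall d a b, eqd (d + e) a b -> eqd d (f a) (f b)) ->
  (forall d a b, eqd (d + e) a b -> eqd d (g a) (g b)) ->
  (forall c, f (fcst c) = g (fcst c)) ->
  (forall a, f a = g a -> f (fX * a) = g (fX * a)) ->
  (forall a, f a = g a -> f (fY * a) = g (fY * a)) -> forall a, f a = g a.
Proof.
move=> fD gD fc gc H0 HX HY; apply: fps_dense => // [a b Ha Hb|a Ha].
  by rewrite fD gD Ha Hb.
apply: eqd_eq => d; have [a' E H] := Ha (d + e)%N.
by apply: (eqd_trans (fc _ _ _ H)); rewrite E; apply: eqd_sym; apply: gc.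
Qed.

(** * Formal partial derivatives *)

Definition dX a : fps K := sderivX a.
Definition dY a : fps K := sderivY a.

Lemma dXD a b : dX (a + b) = dX a + dX b.
Proof. by apply: fps_ext => i j; rewrite /dX /sderivX coefDf mulrnDl. Qed.
Lemma dYD a b : dY (a + b) = dY a + dY b.
Proof. by apply: fps_ext => i j; rewrite /dY /sderivY coefDf mulrnDl. Qed.
Lemma dX_eqd d a b : eqd d.+1 a b -> eqd d (dX a) (dX b).
Proof. by move=> H i j L; rewrite /dX /sderivX H. Qed.
Lemma dY_eqd d a b : eqd d.+1 a b -> eqd d (dY a) (dY b).
Proof. by move=> H i j L; rewrite /dY /sderivY H // addnS. Qed.
Lemma dXC c : dX (fcst c) = 0.
Proof. by apply: fps_ext => i j; rewrite /dX /sderivX coefCf mul0rn. Qed.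
Lemma dYC c : dY (fcst c) = 0.
Proof. by apply: fps_ext => i j; rewrite /dY /sderivY coefCf andbF mul0rn. Qed.
Lemma dXX a : dX (fX * a) = a + fX * dX a.
Proof.
apply: fps_ext => i j; rewrite /dX /sderivX coefDf !coefXM.
by case: i => [|i]; rewrite ?mulr1n ?addr0 // mulrS.
Qed.
Lemma dXY a : dX (fY * a) = fY * dX a.
Proof.
by apply: fps_ext => i j; rewrite /dX /sderivX !coefYM; case: j => // ; rewrite mul0rn.
Qed.
Lemma dYX a : dY (fX * a) = fX * dY a.
Proof.
by apply: fps_ext => i j; rewrite /dY /sderivY !coefXM; case: i => // ; rewrite mul0rn.
Qed.
Lemma dYY a : dY (fY * a) = a + fY * dY a.
Proof.
apply: fps_ext => i j; rewrite /dY /sderivY coefDf !coefYM.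
by case: j => [|j]; rewrite ?mulr1n ?addr0 // mulrS.
Qed.
Lemma dXCM c a : dX (fcst c * a) = fcst c * dX a.
Proof. by apply: fps_ext => i j; rewrite coefCM /dX /sderivX coefCM mulrnAr. Qed.
Lemma dYCM c a : dY (fcst c * a) = fcst c * dY a.
Proof. by apply: fps_ext => i j; rewrite coefCM /dY /sderivY coefCM mulrnAr. Qed.

Lemma dXM a b : dX (a * b) = dX a * b + a * dX b.
Proof.
move: a; apply: (@fps_operator_eq 1).
- by move=> a a'; rewrite mulrDl dXD.
- by move=> a a'; rewrite dXD !mulrDl; ring.
- by move=> d a a' H; apply: dX_eqd; apply: eqdM => //; rewrite -addn1.
- move=> d a a'; rewrite addn1 => H; apply: eqdD; apply: eqdM => //; first exact: dX_eqd.
  exact: eqd_leq H.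
- by move=> c; rewrite dXCM dXC mul0r add0r.
- by move=> a E; rewrite -mulrA !dXX E; ring.
- by move=> a E; rewrite -mulrA !dXY E; ring.
Qed.
Lemma dYM a b : dY (a * b) = dY a * b + a * dY b.
Proof.
move: a; apply: (@fps_operator_eq 1).
- by move=> a a'; rewrite mulrDl dYD.
- by move=> a a'; rewrite dYD !mulrDl; ring.
- by move=> d a a' H; apply: dY_eqd; apply: eqdM => //; rewrite -addn1.
- move=> d a a'; rewrite addn1 => H; apply: eqdD; apply: eqdM => //; first exact: dY_eqd.
  exact: eqd_leq H.
- by move=> c; rewrite dYCM dYC mul0r add0r.
- by move=> a E; rewrite -mulrA !dYX E; ring.
- by move=> a E; rewrite -mulrA !dYY E; ring.
Qed.
Lemma dX_X : dX fX = 1.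
Proof. by rewrite -[fX]mulr1 dXX -fcst1 dXC mulr0 addr0. Qed.
Lemma dX_Y : dX fY = 0.
Proof. by rewrite -[fY]mulr1 dXY -fcst1 dXC mulr0. Qed.
Lemma dY_X : dY fX = 0.
Proof. by rewrite -[fX]mulr1 dYX -fcst1 dYC mulr0. Qed.
Lemma dY_Y : dY fY = 1.
Proof. by rewrite -[fY]mulr1 dYY -fcst1 dYC mulr0 addr0. Qed.

End PowerSeriesRing.

(** * Composition *)

Section Composition.
Variable K : numFieldType.
Implicit Types (a b p q : fps K) (c : K).

Definition fcomp a p q : fps K := scomp a p q.

Lemma sexpE a n : sexp a n = a ^+ n.
Proof. by elim: n => // n IH; rewrite exprS -IH. Qed.

Lemma fcompE a p q i j : fcomp a p q i j =
  \sum_(m < (i + j).+1) \sum_(n < (i + j).+1) a m n * (p ^+ m * q ^+ n) i j.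
Proof.
rewrite /fcomp /scomp; apply: eq_bigr => m _; apply: eq_bigr => n _.
by rewrite !sexpE.
Qed.

Lemma big_ord_shrink (M N : nat) (F : nat -> K) : (M <= N)%N ->
  (forall m, (M <= m)%N -> F m = 0) -> \sum_(m < N) F m = \sum_(m < M) F m.
Proof.
move=> L H; rewrite (big_ord_widen N F L) [RHS]big_mkcond /=; apply: eq_bigr => m _.
by case: ifP => // /negbT; rewrite -leqNgt => /H.
Qed.

Lemma eqd_sum0 d I (r : seq I) (P : pred I) (F : I -> fps K) :
  (forall k, P k -> eqd d (F k) 0) -> eqd d (\sum_(k <- r | P k) F k) 0.
Proof.
by move=> H; elim/big_rec: _ => // k x Pk E; rewrite -[X in eqd _ _ X]addr0; apply: eqdD; auto.
Qed.

Lemma eqd_0M d a b : eqd d b 0 -> eqd d (a * b) 0.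
Proof. by move=> H; rewrite -[X in eqd _ _ X](mulr0 a); apply: eqdM. Qed.

Section Fixed.
Variables p q : fps K.
Hypotheses (p0 : p 0%N 0%N = 0) (q0 : q 0%N 0%N = 0).

Lemma eqd_mono m n : eqd (m + n) (p ^+ m * q ^+ n) 0.
Proof. by apply: eqd_M0; apply: eqd_X0. Qed.

(** The range of the double sum in [scomp] varies with the coefficient. A common range serves all
    degrees below [d], because [p ^+ m * q ^+ n] has order at least [m + n]; algebra is then done on
    one finite sum. *)
Lemma fcomp_sum (d N : nat) a : (d <= N)%N ->
  eqd d (fcomp a p q) (\sum_(m < N) \sum_(n < N) fcst (a m n) * (p ^+ m * q ^+ n)).
Proof.
move=> LN i j L; rewrite fcompE coef_sumf.
have -> : \sum_(k < N) (\sum_(n < N) fcst (a k n) * (p ^+ k * q ^+ n)) i j =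
  \sum_(k < N) \sum_(n < N) a k n * (p ^+ k * q ^+ n) i j.
  by apply: eq_bigr => m _; rewrite coef_sumf; apply: eq_bigr => n _; rewrite coefCM.
have Z m n : (i + j < m + n)%N -> a m n * (p ^+ m * q ^+ n) i j = 0.
  by move=> L'; rewrite (eqd_mono L') mulr0.
rewrite (@big_ord_shrink (i + j).+1 N
  (fun m => \sum_(n < N) a m n * (p ^+ m * q ^+ n) i j)); last 2 first.
- exact: leq_trans LN.
- by move=> m L'; rewrite big1 // => n _; apply: Z; lia.
apply: eq_bigr => m _; symmetry.
apply: (@big_ord_shrink _ _ (fun n => a m n * (p ^+ m * q ^+ n) i j)); first exact: leq_trans LN.
by move=> n L'; apply: Z; lia.
Qed.

Lemma fcompD a b : fcomp (a + b) p q = fcomp a p q + fcomp b p q.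
Proof.
apply: fps_ext => i j; rewrite coefDf !fcompE -big_split; apply: eq_bigr => m _ /=.
by rewrite -big_split; apply: eq_bigr => n _ /=; rewrite coefDf mulrDl.
Qed.

Lemma fcompC c : fcomp (fcst c) p q = fcst c.
Proof.
apply: fps_ext => i j; rewrite fcompE (bigD1 ord0) //= (bigD1 ord0) //= coefCf /=.
rewrite !expr0 mulr1 coef1f !big1 ?addr0.
- by rewrite coefCf; case: ifP; rewrite ?mulr1 ?mulr0.
- move=> [[|m] Hm] //= _; rewrite big1 // => n _; by rewrite coefCf /= mul0r.
- by move=> [[|m] Hm] //= _; rewrite coefCf /= mul0r.
Qed.

Lemma fcomp_eqd d a b : eqd d a b -> eqd d (fcomp a p q) (fcomp b p q).
Proof.
move=> H i j L; rewrite !fcompE; apply: eq_bigr => m _; apply: eq_bigr => n _.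
have [L'|L'] := ltnP (m + n) d; first by rewrite H.
by rewrite (eqd_mono (leq_trans L L')) !mulr0.
Qed.

Lemma fcompXM a : fcomp (fX _ * a) p q = p * fcomp a p q.
Proof.
apply: eqd_eq => d; apply: (eqd_trans (fcomp_sum _ (leqnSn d))).
apply: eqd_trans; last first.
  by apply: eqdM; [exact: eqd_refl|apply: eqd_sym; exact: (fcomp_sum _ (leqnSn d))].
rewrite big_ord_recl big1 ?add0r; last by move=> n _; rewrite coefXM fcst0 mul0r.
rewrite [X in eqd _ _ (_ * X)]big_ord_recr /= mulrDr.
have -> : \sum_(i < d) \sum_(n < d.+1) fcst ((fX K * a) (bump 0 i) n) * (p ^+ bump 0 i * q ^+ n)
   = p * \sum_(i < d) \sum_(n < d.+1) fcst (a i n) * (p ^+ i * q ^+ n).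
  rewrite mulr_sumr; apply: eq_bigr => m _; rewrite mulr_sumr; apply: eq_bigr => n _.
  by rewrite coefXM exprS; ring.
(* The shift of index leaves over the summand carrying [p ^+ d], which is invisible below degree
   [d]. *)
rewrite -[X in eqd _ X]addr0; apply: eqdD => //; apply: eqd_sym.
apply: eqd_0M; apply: eqd_sum0 => n _; apply: eqd_0M.
apply: (@eqd_leq _ _ (d + n)); last exact: eqd_mono.
exact: leq_addr.
Qed.

Lemma fcompYM a : fcomp (fY _ * a) p q = q * fcomp a p q.
Proof.
apply: eqd_eq => d; apply: (eqd_trans (fcomp_sum _ (leqnSn d))).
apply: eqd_trans; last first.
  by apply: eqdM; [exact: eqd_refl|apply: eqd_sym; exact: (fcomp_sum _ (leqnSn d))].
rewrite mulr_sumr; apply: eqd_sum => m _.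
rewrite big_ord_recl coefYM fcst0 mul0r add0r [X in eqd _ _ (_ * X)]big_ord_recr /= mulrDr.
have -> : \sum_(i < d) fcst ((fY K * a) m (bump 0 i)) * (p ^+ m * q ^+ bump 0 i)
   = q * \sum_(i < d) fcst (a m i) * (p ^+ m * q ^+ i).
  rewrite mulr_sumr; apply: eq_bigr => n _.
  by rewrite coefYM exprS; ring.
rewrite -[X in eqd _ X]addr0; apply: eqdD => //; apply: eqd_sym.
do 2?apply: eqd_0M.
apply: (@eqd_leq _ _ (m + d)); last exact: eqd_mono.
exact: leq_addl.
Qed.

Lemma fcomp1 : fcomp 1 p q = 1. Proof. exact: fcompC. Qed.
Lemma fcomp0 : fcomp 0 p q = 0. Proof. by rewrite -fcst0 fcompC. Qed.
Lemma fcompX : fcomp (fX _) p q = p.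
Proof. by rewrite -[fX K]mulr1 fcompXM fcomp1 mulr1. Qed.
Lemma fcompY : fcomp (fY _) p q = q.
Proof. by rewrite -[fY K]mulr1 fcompYM fcomp1 mulr1. Qed.

Lemma fcompCM c a : fcomp (fcst c * a) p q = fcst c * fcomp a p q.
Proof.
apply: fps_ext => i j; rewrite coefCM !fcompE mulr_sumr; apply: eq_bigr => m _.
by rewrite mulr_sumr; apply: eq_bigr => n _; rewrite coefCM mulrA.
Qed.

Lemma fcompM a b : fcomp (a * b) p q = fcomp a p q * fcomp b p q.
Proof.
move: a; apply: (@fps_operator_eq _ 0).
- by move=> a a'; rewrite mulrDl fcompD.
- by move=> a a'; rewrite fcompD mulrDl.
- by move=> d a a'; rewrite addn0 => H; apply: fcomp_eqd; apply: eqdM.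
- by move=> d a a'; rewrite addn0 => H; apply: eqdM => //; apply: fcomp_eqd.
- by move=> c; rewrite fcompCM fcompC.
- by move=> a E; rewrite -mulrA !fcompXM E mulrA.
- by move=> a E; rewrite -mulrA !fcompYM E mulrA.
Qed.

Lemma fcompN a : fcomp (- a) p q = - fcomp a p q.
Proof. by apply/eqP; rewrite -addr_eq0 -fcompD addNr fcomp0. Qed.
Lemma fcompB a b : fcomp (a - b) p q = fcomp a p q - fcomp b p q.
Proof. by rewrite fcompD fcompN. Qed.
Lemma fcompXn a n : fcomp (a ^+ n) p q = fcomp a p q ^+ n.
Proof. by elim: n => [|n IH]; rewrite ?fcomp1 // !exprS fcompM IH. Qed.

Lemma coef00_comp a : fcomp a p q 0%N 0%N = a 0%N 0%N.
Proof. by rewrite fcompE !big_ord1 !expr0 mulr1 coef1f mulr1. Qed.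

(** Stated for any continuous derivation because, besides [dX] and [dY], it is applied in the
    welding to a derivation tangent to the leaves. *)
Lemma fcomp_chain (dv : fps K -> fps K) a :
  (forall a b, dv (a + b) = dv a + dv b) ->
  (forall a b, dv (a * b) = dv a * b + a * dv b) ->
  (forall c, dv (fcst c) = 0) ->
  (forall d a b, eqd d.+1 a b -> eqd d (dv a) (dv b)) ->
  dv (fcomp a p q) = fcomp (dX a) p q * dv p + fcomp (dY a) p q * dv q.
Proof.
move=> dvD dvM dvC dvc; move: a; apply: (@fps_operator_eq _ 1).
- by move=> a a'; rewrite fcompD dvD.
- by move=> a a'; rewrite dXD dYD !fcompD; ring.
- by move=> d a a'; rewrite addn1 => H; apply: dvc; apply: fcomp_eqd.
- move=> d a a'; rewrite addn1 => H.
  by apply: eqdD; apply: eqdM => //; apply: fcomp_eqd; [apply: dX_eqd|apply: dY_eqd].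
- by move=> c; rewrite fcompC dvC dXC dYC !fcomp0 !mul0r addr0.
- by move=> a E; rewrite fcompXM dvM E dXX dYX fcompD !fcompXM; ring.
- by move=> a E; rewrite fcompYM dvM E dXY dYY fcompD !fcompYM; ring.
Qed.

Lemma dX_comp a : dX (fcomp a p q) = fcomp (dX a) p q * dX p + fcomp (dY a) p q * dX q.
Proof.
apply: fcomp_chain; [exact: dXD|exact: dXM|exact: dXC|exact: dX_eqd].
Qed.
Lemma dY_comp a : dY (fcomp a p q) = fcomp (dX a) p q * dY p + fcomp (dY a) p q * dY q.
Proof.
apply: fcomp_chain; [exact: dYD|exact: dYM|exact: dYC|exact: dY_eqd].
Qed.

Lemma fcomp_trd d a : eqd d (fcomp a p q)
  (\sum_(n < d) \sum_(i < n.+1) fcst (a i (n - i)%N) * (p ^+ i * q ^+ (n - i))).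
Proof.
apply: (eqd_trans (fcomp_eqd (@eqd_trd _ d a))).
have fs I (r : seq I) P (F : I -> fps K) :
    fcomp (\sum_(k <- r | P k) F k) p q = \sum_(k <- r | P k) fcomp (F k) p q.
  by elim/big_rec2: _ => [|k x y _ <-]; rewrite ?fcomp0 ?fcompD.
rewrite /trd fs; apply: eqd_sum => n _; rewrite fs; apply: eqd_sum => i _.
by rewrite fcompCM fcompM !fcompXn fcompX fcompY.
Qed.

End Fixed.

Lemma fcomp_eqd_args d a p q p' q' :
  p 0%N 0%N = 0 -> q 0%N 0%N = 0 -> p' 0%N 0%N = 0 -> q' 0%N 0%N = 0 ->
  eqd d p p' -> eqd d q q' -> eqd d (fcomp a p q) (fcomp a p' q').
Proof.
move=> p0 q0 p0' q0' Hp Hq; apply: (eqd_trans (fcomp_sum p0 q0 _ (leqnn d))).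
apply: eqd_sym; apply: (eqd_trans (fcomp_sum p0' q0' _ (leqnn d))).
apply: eqd_sum => m _; apply: eqd_sum => n _; apply: eqdM => //.
by apply: eqdM; apply: eqdX; apply: eqd_sym.
Qed.

Lemma fcompA a P Q p q :
  P 0%N 0%N = 0 -> Q 0%N 0%N = 0 -> p 0%N 0%N = 0 -> q 0%N 0%N = 0 ->
  fcomp (fcomp a P Q) p q = fcomp a (fcomp P p q) (fcomp Q p q).
Proof.
move=> P0 Q0 p0 q0.
have P0' : fcomp P p q 0%N 0%N = 0 by rewrite coef00_comp.
have Q0' : fcomp Q p q 0%N 0%N = 0 by rewrite coef00_comp.
move: a; apply: (@fps_operator_eq _ 0).
- by move=> a a'; rewrite !fcompD.
- by move=> a a'; rewrite !fcompD.
- by move=> d a a'; rewrite addn0 => H; do 2?apply: fcomp_eqd.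
- by move=> d a a'; rewrite addn0 => H; apply: fcomp_eqd.
- by move=> c; rewrite !fcompC.
- by move=> a E; rewrite !fcompXM // fcompM // E.
- by move=> a E; rewrite !fcompYM // fcompM // E.
Qed.

Lemma fcomp_id a : fcomp a (fX K) (fY K) = a.
Proof.
have X0 : fX K 0%N 0%N = 0 by rewrite coefXE.
have Y0 : fY K 0%N 0%N = 0 by rewrite coefYE.
move: a; apply: (@fps_operator_eq _ 0 (fun a => fcomp a _ _) id) => //.
- by move=> a a'; rewrite !fcompD.
- by move=> d a a'; rewrite addn0 => H; do 2?apply: fcomp_eqd.
- by move=> d a a'; rewrite addn0.
- by move=> c; rewrite !fcompC.
- by move=> a E; rewrite !fcompXM // E.
- by move=> a E; rewrite !fcompYM // E.
Qed.

End Composition.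

(** * Truncated norms and convergence *)

(** The norm of [R[i]] takes its values in [R[i]], whereas the estimates need a totally ordered
    target; hence a separate real-valued [nr]. The clause on integers controls the denominators of
    primitives and the factors produced by derivatives. *)
Record absolute_value (K : numFieldType) (R : realType) (nr : K -> R) : Prop :=
  AbsoluteValue {
    nr_ge0 : forall x, 0 <= nr x;
    nrD : forall x y, nr (x + y) <= nr x + nr y;
    nrM : forall x y, nr (x * y) = nr x * nr y;
    nrN : forall x, nr (- x) = nr x;
    nr_nat : forall n : nat, nr n%:R = n%:R }.

Section Norms.
Variables (K : numFieldType) (R : realType) (nr : K -> R).
Hypothesis nrP : absolute_value nr.
Implicit Types (a b p q : fps K) (c : K) (r s t : R) (d : nat).

(** A weighted l1 norm, cut at degree [d] so that it makes sense for every formal series;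
    convergence becomes a bound uniform in [d]. *)
Definition fnorm d r a : R :=
  \sum_(n < d) \sum_(i < n.+1) nr (a i (n - i)%N) * r ^+ n.

Definition bounded_at r C a := forall d, fnorm d r a <= C.
Definition analytic a := exists r C, 0 < r /\ bounded_at r C a.

Lemma nr0 : nr 0 = 0. Proof. exact: (nr_nat nrP 0). Qed.
Lemma nr1 : nr 1 = 1. Proof. exact: (nr_nat nrP 1). Qed.
Lemma nrV c : c != 0 -> nr c^-1 = (nr c)^-1.
Proof.
move=> c0; have E : nr c * nr c^-1 = 1 by rewrite -(nrM nrP) mulfV // nr1.
have nc : nr c != 0 by apply: contra_eq_neq E => ->; rewrite mul0r eq_sym oner_eq0.
by apply: (mulfI nc); rewrite E mulfV.
Qed.

Lemma fnorm_ge0 d r a : 0 <= r -> 0 <= fnorm d r a.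
Proof.
move=> r0; apply: sumr_ge0 => n _; apply: sumr_ge0 => i _.
by rewrite mulr_ge0 ?exprn_ge0 ?(nr_ge0 nrP).
Qed.

Lemma fnorm_dom d r r' a b : 0 <= r -> r <= r' ->
  (forall i j, (i + j < d)%N -> nr (a i j) <= nr (b i j)) -> fnorm d r a <= fnorm d r' b.
Proof.
move=> r0 rr' H; apply: ler_sum => n _; apply: ler_sum => i _.
apply: ler_pM; rewrite ?(nr_ge0 nrP) ?exprn_ge0 ?lerXn2r ?nnegrE ?(le_trans r0) //.
by apply: H; have := ltn_ord n; have := ltn_ord i; lia.
Qed.

Lemma fnorm_eqd d r a b : eqd d a b -> fnorm d r a = fnorm d r b.
Proof.
move=> H; apply: eq_bigr => n _; apply: eq_bigr => i _; rewrite H //.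
by have := ltn_ord n; have := ltn_ord i; lia.
Qed.

Lemma fnormS d r a : fnorm d.+1 r a =
  fnorm d r a + \sum_(i < d.+1) nr (a i (d - i)%N) * r ^+ d.
Proof. by rewrite /fnorm big_ord_recr. Qed.

Lemma fnorm_leq d e r a : 0 <= r -> (d <= e)%N -> fnorm d r a <= fnorm e r a.
Proof.
move=> r0; elim: e => [|e IH]; first by rewrite leqn0 => /eqP ->.
rewrite leq_eqVlt => /orP[/eqP ->//|]; rewrite ltnS => /IH L; apply: (le_trans L).
rewrite fnormS lerDl; apply: sumr_ge0 => i _.
by rewrite mulr_ge0 ?exprn_ge0 ?(nr_ge0 nrP).
Qed.

Lemma fnormD d r a b : 0 <= r -> fnorm d r (a + b) <= fnorm d r a + fnorm d r b.
Proof.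
move=> r0; rewrite /fnorm -big_split; apply: ler_sum => n _ /=; rewrite -big_split.
apply: ler_sum => i _ /=; rewrite -mulrDl ler_wpM2r ?exprn_ge0 // coefDf; exact: (nrD nrP).
Qed.

Lemma fnormN d r a : fnorm d r (- a) = fnorm d r a.
Proof. by apply: eq_bigr => n _; apply: eq_bigr => i _; rewrite coefNf (nrN nrP). Qed.

Lemma fnorm0 d r : fnorm d r 0 = 0.
Proof. by rewrite /fnorm big1 // => n _; rewrite big1 // => i _; rewrite nr0 mul0r. Qed.

Lemma fnorm_sum d r I (l : seq I) (P : pred I) (F : I -> fps K) : 0 <= r ->
  fnorm d r (\sum_(k <- l | P k) F k) <= \sum_(k <- l | P k) fnorm d r (F k).
Proof.
move=> r0; elim/big_rec2: _ => [|k x y _ L]; first by rewrite fnorm0.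
by apply: le_trans (fnormD _ _ _ r0) _; rewrite lerD2l.
Qed.

Lemma fnormCM d r c a : fnorm d r (fcst c * a) = nr c * fnorm d r a.
Proof.
rewrite /fnorm mulr_sumr; apply: eq_bigr => n _; rewrite mulr_sumr; apply: eq_bigr => i _.
by rewrite coefCM (nrM nrP) mulrA.
Qed.

Lemma fnormXMS d r a : fnorm d.+1 r (fX K * a) = r * fnorm d r a.
Proof.
rewrite /fnorm big_ord_recl big_ord1 coefXM nr0 mul0r add0r mulr_sumr.
apply: eq_bigr => n _; rewrite big_ord_recl coefXM nr0 mul0r add0r mulr_sumr.
apply: eq_bigr => i _; rewrite coefXM mulrCA -exprS /=; congr (nr (a _ _) * _).
Qed.

Lemma fnormYMS d r a : fnorm d.+1 r (fY K * a) = r * fnorm d r a.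
Proof.
rewrite /fnorm big_ord_recl big_ord1 coefYM nr0 mul0r add0r mulr_sumr.
apply: eq_bigr => n _; rewrite big_ord_recr coefYM /= subnn nr0 mul0r addr0 mulr_sumr.
apply: eq_bigr => i _; rewrite coefYM mulrCA -exprS /=.
by rewrite [(_ - i)%N](_ : _ = (n - i).+1) // subSn // -ltnS.
Qed.

Lemma fnormXM d r a : 0 <= r -> fnorm d r (fX K * a) <= r * fnorm d r a.
Proof.
move=> r0; rewrite -fnormXMS; exact: fnorm_leq.
Qed.

Lemma fnormYM d r a : 0 <= r -> fnorm d r (fY K * a) <= r * fnorm d r a.
Proof.
move=> r0; rewrite -fnormYMS; exact: fnorm_leq.
Qed.

Lemma fnorm_mono d r m n a : 0 <= r ->
  fnorm d r (fX K ^+ m * fY K ^+ n * a) <= r ^+ (m + n) * fnorm d r a.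
Proof.
move=> r0; elim: m => [|m IH].
  rewrite expr0 mul1r; elim: n => [|n IH]; first by rewrite !expr0 !mul1r.
  rewrite !exprS -!mulrA; apply: (le_trans (fnormYM _ _ r0)); exact: ler_wpM2l.
rewrite exprS addSn exprS -!mulrA; apply: (le_trans (fnormXM _ _ r0)).
by apply: ler_wpM2l => //; rewrite mulrA.
Qed.

(** The first factor may be cut at degree [d] and expanded into monomials; multiplying by a monomial
    of degree [n] costs at most [r ^+ n]. *)
Lemma fnormM d r a b : 0 <= r -> fnorm d r (a * b) <= fnorm d r a * fnorm d r b.
Proof.
move=> r0; rewrite (@fnorm_eqd d r _ (trd d a * b)); last first.
  by apply: eqdM => //; apply: eqd_trd.
rewrite /trd mulr_suml; apply: (le_trans (fnorm_sum _ _ _ _ r0)).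
rewrite /fnorm -/(fnorm d r b) mulr_suml; apply: ler_sum => n _; rewrite mulr_suml.
apply: (le_trans (fnorm_sum _ _ _ _ r0)).
rewrite mulr_suml; apply: ler_sum => i _.
rewrite -[X in fnorm _ _ X]mulrA fnormCM -[X in _ <= X]mulrA ler_wpM2l ?(nr_ge0 nrP) //.
apply: (le_trans (fnorm_mono _ _ _ _ r0)).
by rewrite subnKC // -ltnS.
Qed.

Lemma fnorm1 d r : 0 <= r -> fnorm d r 1 <= 1.
Proof.
move=> r0; case: d => [|d]; first by rewrite /fnorm big_ord0.
rewrite /fnorm big_ord_recl big_ord1 coef1f /= nr1 expr0 mulr1 big1 ?addr0 // => n _.
rewrite big1 // => i _; rewrite coef1f /=.
suff -> : ((i : nat) == 0%N) && ((bump 0 n - i)%N == 0%N) = false by rewrite nr0 mul0r.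
by case: (nat_of_ord i).
Qed.

Lemma fnormC d r c : 0 <= r -> fnorm d r (fcst c) <= nr c.
Proof.
move=> r0; rewrite -[fcst c]mulr1 fnormCM -[X in _ <= X]mulr1.
by apply: ler_wpM2l; [exact: (nr_ge0 nrP)|exact: fnorm1].
Qed.

Lemma fnorm_X d r : 0 <= r -> fnorm d r (fX K) <= r.
Proof.
move=> r0; rewrite -[fX K]mulr1; apply: (le_trans (fnormXM _ _ r0)).
by rewrite -[X in _ <= X]mulr1; apply: ler_wpM2l => //; exact: fnorm1.
Qed.
Lemma fnorm_Y d r : 0 <= r -> fnorm d r (fY K) <= r.
Proof.
move=> r0; rewrite -[fY K]mulr1; apply: (le_trans (fnormYM _ _ r0)).
by rewrite -[X in _ <= X]mulr1; apply: ler_wpM2l => //; exact: fnorm1.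
Qed.

Lemma fnormMle d r a b s t : 0 <= r -> fnorm d r a <= s -> fnorm d r b <= t ->
  fnorm d r (a * b) <= s * t.
Proof.
move=> r0 Ha Hb; apply: (le_trans (fnormM _ _ _ r0)).
by apply: ler_pM => //; apply: fnorm_ge0.
Qed.

Lemma fnormXle d r a n s : 0 <= r -> fnorm d r a <= s -> fnorm d r (a ^+ n) <= s ^+ n.
Proof.
move=> r0 Ha; elim: n => [|n IH]; first exact: fnorm1.
by rewrite !exprS; apply: fnormMle.
Qed.

(** A monomial of degree [n] in [p] and [q] has norm at most [s ^+ n], so the outer series is in
    effect taken at radius [s]. This replaces any discussion of domains of definition. *)
Lemma fnorm_comp d r s a p q : 0 <= r -> p 0%N 0%N = 0 -> q 0%N 0%N = 0 ->
  fnorm d r p <= s -> fnorm d r q <= s -> fnorm d r (fcomp a p q) <= fnorm d s a.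
Proof.
move=> r0 p0 q0 Hp Hq; rewrite (fnorm_eqd r (fcomp_trd p0 q0 a)).
apply: (le_trans (fnorm_sum _ _ _ _ r0)); apply: ler_sum => n _.
apply: (le_trans (fnorm_sum _ _ _ _ r0)); apply: ler_sum => i _.
rewrite fnormCM ler_wpM2l ?(nr_ge0 nrP) //.
have -> : s ^+ n = s ^+ i * s ^+ (n - i) by rewrite -exprD subnKC // -ltnS.
by apply: fnormMle => //; apply: fnormXle.
Qed.

Lemma fnorm_scale d r s a : 0 <= r -> 0 <= s <= 1 -> a 0%N 0%N = 0 ->
  fnorm d (s * r) a <= s * fnorm d r a.
Proof.
move=> r0 /andP[s0 s1] a0; rewrite /fnorm mulr_sumr; apply: ler_sum => n _.
rewrite mulr_sumr; apply: ler_sum => i _; case: n i => -[|n] Hn i /=.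
  by rewrite ord1 a0 nr0 !mul0r mulr0.
rewrite mulrCA ler_wpM2l ?(nr_ge0 nrP) // exprMn ler_wpM2r ?exprn_ge0 //.
by rewrite exprS ler_piMr // exprn_ile1.
Qed.

Lemma bounded_at_le r r' C C' a : 0 <= r' -> r' <= r -> C <= C' ->
  bounded_at r C a -> bounded_at r' C' a.
Proof.
move=> r0 L1 L2 H d; apply: (le_trans _ (le_trans (H d) L2)).
exact: fnorm_dom.
Qed.

Lemma analytic_dom a b : (forall i j, nr (a i j) <= nr (b i j)) -> analytic b -> analytic a.
Proof.
move=> H [r [C [r0 Hb]]]; exists r, C; split=> // d; apply: (le_trans _ (Hb d)).
by apply: fnorm_dom => //; apply: ltW.
Qed.

Lemma analytic2 a b : analytic a -> analytic b ->
  exists r C, [/\ 0 < r, 1 <= C, bounded_at r C a & bounded_at r C b].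
Proof.
move=> [r [C [r0 Ha]]] [r' [C' [r0' Hb]]].
exists (Num.min r r'), (Num.max 1 (Num.max C C')).
have m0 : 0 < Num.min r r' by rewrite lt_min r0.
split=> //; first by rewrite le_max lexx.
  by apply: bounded_at_le Ha; rewrite ?(ltW m0) // ?ge_min ?le_max ?le_max lexx ?orbT.
by apply: bounded_at_le Hb; rewrite ?(ltW m0) // ?ge_min ?le_max ?le_max lexx ?orbT.
Qed.

Lemma analyticD a b : analytic a -> analytic b -> analytic (a + b).
Proof.
move=> Ha Hb; have [r [C [r0 C1 Ba Bb]]] := analytic2 Ha Hb.
exists r, (C + C); split=> // d; apply: (le_trans (fnormD _ _ _ (ltW r0))).
exact: lerD.
Qed.
Lemma analyticN a : analytic a -> analytic (- a).
Proof. by apply: analytic_dom => i j; rewrite coefNf (nrN nrP). Qed.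
Lemma analyticB a b : analytic a -> analytic b -> analytic (a - b).
Proof. by move=> Ha Hb; apply: analyticD => //; apply: analyticN. Qed.
Lemma analyticM a b : analytic a -> analytic b -> analytic (a * b).
Proof.
move=> Ha Hb; have [r [C [r0 C1 Ba Bb]]] := analytic2 Ha Hb.
by exists r, (C * C); split=> // d; apply: fnormMle => //; exact: ltW.
Qed.
Lemma analyticC c : analytic (fcst c).
Proof. by exists 1, (nr c); split=> // d; apply: fnormC. Qed.
Lemma analytic0 : analytic 0. Proof. by rewrite -fcst0; apply: analyticC. Qed.
Lemma analytic1 : analytic 1. Proof. exact: analyticC. Qed.
Lemma analyticX : analytic (fX K).
Proof. by exists 1, 1; split=> // d; apply: fnorm_X. Qed.
Lemma analyticY : analytic (fY K).
Proof. by exists 1, 1; split=> // d; apply: fnorm_Y. Qed.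
Lemma analyticXn a n : analytic a -> analytic (a ^+ n).
Proof.
move=> Ha; elim: n => [|n IH]; first exact: analytic1.
by rewrite exprS; apply: analyticM.
Qed.

(** Every monomial present has positive degree, so shrinking the radius by a factor [s <= 1] shrinks
    the norm at least as much; [t / C] is the factor required. *)
Lemma small_radius a t : analytic a -> a 0%N 0%N = 0 -> 0 < t ->
  exists2 r, 0 < r & bounded_at r t a.
Proof.
move=> Ha a0 t0; have [r [C [r0 C1 Ba _]]] := analytic2 Ha Ha.
have C0 : 0 < C by rewrite (lt_le_trans _ C1).
set s := Num.min 1 (t / C); have s0 : 0 < s by rewrite lt_min ltr01 divr_gt0.
exists (s * r); first exact: mulr_gt0.
move=> d; apply: (le_trans (fnorm_scale _ (ltW r0) _ a0)).
  by rewrite ltW //= ge_min lexx.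
apply: (@le_trans _ _ (t / C * C)); last by rewrite divfK // gt_eqF.
apply: ler_pM => //; [exact: ltW|apply: fnorm_ge0; exact: ltW|].
by rewrite ge_min lexx orbT.
Qed.

Lemma analytic_comp a p q : analytic a -> analytic p -> analytic q ->
  p 0%N 0%N = 0 -> q 0%N 0%N = 0 -> analytic (fcomp a p q).
Proof.
move=> [s [C [s0 Ba]]] Hp Hq p0 q0.
have [r r0 Br] := small_radius Hp p0 s0; have [r' r0' Br'] := small_radius Hq q0 s0.
have m0 : 0 < Num.min r r' by rewrite lt_min r0.
exists (Num.min r r'), C; split=> // d; apply: (le_trans _ (Ba d)).
apply: fnorm_comp => //; first exact: ltW.
- by apply: (bounded_at_le _ _ (lexx s) Br); rewrite ?(ltW m0) // ?ge_min lexx.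
- by apply: (bounded_at_le _ _ (lexx s) Br'); rewrite ?(ltW m0) // ?ge_min lexx ?orbT.
Qed.

Lemma bounded_shX r C a : 0 < r -> bounded_at r C a -> bounded_at r (C / r) (shX a).
Proof.
move=> r0 Ba d; rewrite ler_pdivlMr // mulrC -fnormXMS; apply: (le_trans _ (Ba d.+1)).
apply: fnorm_dom => //; first exact: ltW.
move=> i j _; rewrite coefXM /shX; case: i => // ; rewrite nr0; exact: (nr_ge0 nrP).
Qed.
Lemma bounded_shY r C a : 0 < r -> bounded_at r C a -> bounded_at r (C / r) (shY a).
Proof.
move=> r0 Ba d; rewrite ler_pdivlMr // mulrC -fnormYMS; apply: (le_trans _ (Ba d.+1)).
apply: fnorm_dom => //; first exact: ltW.
move=> i j _; rewrite coefYM /shY; case: j => // ; rewrite nr0; exact: (nr_ge0 nrP).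
Qed.
Lemma analytic_shX a : analytic a -> analytic (shX a).
Proof. by move=> [r [C [r0 Ba]]]; exists r, (C / r); split=> //; apply: bounded_shX. Qed.
Lemma analytic_shY a : analytic a -> analytic (shY a).
Proof. by move=> [r [C [r0 Ba]]]; exists r, (C / r); split=> //; apply: bounded_shY. Qed.
Lemma analytic_shY0 a : analytic a -> analytic (shY0 a).
Proof.
move=> /analytic_shY; apply: analytic_dom => i j; rewrite /shY0 /shY.
by case: ifP => // _; rewrite nr0 (nr_ge0 nrP).
Qed.

(** Halving the radius absorbs the linear factor, since [n + 1 <= 2 ^ n]. *)
Lemma analytic_grow a b : (forall i j, nr (a i j) <= (i + j).+1%:R * nr (b i j)) ->
  analytic b -> analytic a.
Proof.
move=> H [r [C [r0 Bb]]]; exists (r / 2), C; split; first by rewrite divr_gt0.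
move=> d; apply: (le_trans _ (Bb d)); apply: ler_sum => n _; apply: ler_sum => i _.
apply: (@le_trans _ _ (n.+1%:R * nr (b i (n - i)%N) * (r / 2) ^+ n)).
  apply: ler_wpM2r; first by rewrite exprn_ge0 // divr_ge0 // ltW.
  by apply: (le_trans (H _ _)); rewrite subnKC // -ltnS.
rewrite mulrAC mulrC; apply: ler_wpM2l; first exact: (nr_ge0 nrP).
rewrite exprMn mulrCA ler_piMr ?exprn_ge0 ?(ltW r0) // exprVn ler_pdivrMr ?exprn_gt0 // mul1r.
by rewrite -natrX ler_nat ltn_expl.
Qed.

Lemma analytic_dX a : analytic a -> analytic (dX a).
Proof.
move=> /analytic_shX; apply: analytic_grow => i j; rewrite /dX /sderivX /shX.
rewrite -[_ *+ i.+1]mulr_natl (nrM nrP) (nr_nat nrP) ler_wpM2r ?(nr_ge0 nrP) // ler_nat; lia.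
Qed.
Lemma analytic_dY a : analytic a -> analytic (dY a).
Proof.
move=> /analytic_shY; apply: analytic_grow => i j; rewrite /dY /sderivY /shY.
rewrite -[_ *+ j.+1]mulr_natl (nrM nrP) (nr_nat nrP) ler_wpM2r ?(nr_ge0 nrP) // ler_nat; lia.
Qed.

(** [1 / (1 + x)] *)
Definition fgeom : fps K := fun i j => if j == 0%N then (-1) ^+ i else 0.

Lemma fgeomE : (1 + fX K) * fgeom = 1.
Proof.
apply: fps_ext => i j; rewrite mulrDl mul1r coefDf coefXM coef1f /fgeom.
by case: i => [|i]; case: j => [|j]; rewrite ?addr0 //= exprS mulN1r addNr.
Qed.

Lemma bounded_geom : bounded_at (1 / 2) 2 fgeom.
Proof.
move=> d; suff E : fnorm d (1 / 2) fgeom = 2 - 2 * (1 / 2) ^+ d.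
  by rewrite E lerBlDr lerDl mulr_ge0 // exprn_ge0 // divr_ge0.
elim: d => [|d IH]; first by rewrite /fnorm big_ord0 expr0 mulr1 subrr.
rewrite fnormS IH big_ord_recr /= big1 ?add0r.
  rewrite /fgeom subnn /=; have -> : nr ((-1) ^+ d) = 1.
    by elim: (d) => [|k]; rewrite ?nr1 // exprS mulN1r (nrN nrP).
  by rewrite exprS; lra.
move=> i _; rewrite /fgeom; suff -> : (d - i)%N == 0%N = false by rewrite nr0 mul0r.
by rewrite subn_eq0 leqNgt ltn_ord.
Qed.

Definition finv1 a : fps K := fcomp fgeom a 0.
Lemma finv1P a : a 0%N 0%N = 0 -> (1 + a) * finv1 a = 1.
Proof.
move=> a0; rewrite /finv1 -{1}(fcompX a0 (coef0f K 0 0)) -{1}(fcomp1 a 0).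
by rewrite -fcompD -fcompM // fgeomE fcomp1.
Qed.
Lemma analytic_finv1 a : a 0%N 0%N = 0 -> analytic a -> analytic (finv1 a).
Proof.
move=> a0 Ha; apply: analytic_comp => //; last exact: analytic0.
by exists (1 / 2), 2; split; [lra|exact: bounded_geom].
Qed.

(** Junk if [a] has no constant term. *)
Definition finv a : fps K :=
  fcst (a 0%N 0%N)^-1 * finv1 (fcst (a 0%N 0%N)^-1 * a - 1).
Lemma finvP a : a 0%N 0%N != 0 -> a * finv a = 1.
Proof.
move=> a0; have E : (fcst (a 0%N 0%N)^-1 * a - 1) 0%N 0%N = 0.
  by rewrite coefBf coefCM coef1f mulVf // subrr.
by move: (finv1P E); rewrite /finv addrCA subrr addr0 => {2}<-; ring.
Qed.
Lemma analytic_finv a : a 0%N 0%N != 0 -> analytic a -> analytic (finv a).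
Proof.
move=> a0 Ha; apply: analyticM; first exact: analyticC.
apply: analytic_finv1; first by rewrite coefBf coefCM coef1f mulVf // subrr.
by apply: analyticB; [apply: analyticM => //; exact: analyticC|exact: analytic1].
Qed.
Lemma coef00_finv a : a 0%N 0%N != 0 -> finv a 0%N 0%N = (a 0%N 0%N)^-1.
Proof.
move=> a0; move/(congr1 (fun a : fps K => a 0%N 0%N)): (finvP a0).
by rewrite coef00M coef1f /= => E; apply: (mulfI a0); rewrite E mulfV.
Qed.
Lemma finv_neq0 a : a 0%N 0%N != 0 -> finv a 0%N 0%N != 0.
Proof. by move=> a0; rewrite coef00_finv // invr_eq0. Qed.

End Norms.

(** * Fixed points of maps that raise the order of agreement *)

Section FixedPoint.
Variables (K : numFieldType) (I : Type).
Implicit Types u v w : I -> fps K.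

Definition centered u := forall i, u i 0%N 0%N = 0.

Variable F : (I -> fps K) -> (I -> fps K).
Hypothesis F_centered : forall u, centered u -> centered (F u).
Hypothesis F_contract : forall d u v, centered u -> centered v ->
  (forall i, eqd d (u i) (v i)) -> forall i, eqd d.+1 (F u i) (F v i).

(** The bound is obtained for all truncations of the fixed point, by induction on the
    degree, so that no completeness is involved. *)
Lemma fixed_point : exists u, [/\ centered u, F u = u &
  forall (R : realType) (nr : K -> R) (r e : R), absolute_value nr -> 0 <= r -> 0 <= e ->
    (forall d w, centered w -> (forall i, fnorm nr d r (w i) <= e) ->
       forall i, fnorm nr d r (F w i) <= e) ->
    forall i, bounded_at nr r e (u i)].
Proof.
pose it n := iter n F (fun=> 0).
have it_c n : centered (it n) by elim: n => [|n IH] //=; apply: F_centered.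
have stepE n : forall i, eqd n (it n i) (it n.+1 i).
  by elim: n => [|n IH] // i; apply: F_contract IH _; exact: it_c.
have itE n m : (n <= m)%N -> forall i, eqd n (it n i) (it m i).
  move=> L i; elim: m L => [|m IH]; first by rewrite leqn0 => /eqP ->.
  rewrite leq_eqVlt => /orP[/eqP ->//|]; rewrite ltnS => L.
  by apply: eqd_trans (IH L) _; apply: eqd_leq (stepE m i).
(* Coefficients of degree [i + j] no longer change after [i + j + 1] iterations, so this diagonal
   choice is the limit. *)
pose u : I -> fps K := fun k i j => it (i + j).+1 k i j.
have uE n i : eqd n (u i) (it n i).
  by move=> k l L; rewrite /u (itE _ _ L).
have uc : centered u by move=> i; rewrite /u it_c.
have Fu : F u = u.
  apply: funext => i; apply: eqd_eq => d.
  apply: (@eqd_trans _ d (it d.+1 i)).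
    by apply: (@eqd_leq _ d d.+1) => //; apply: F_contract => //; exact: uE.
  by apply: eqd_sym; apply: (@eqd_leq _ d d.+1) => //; exact: uE.
exists u; split=> // R nr r e nrP r0 e0 H i d; elim: d i => [|d IH] i.
  by rewrite /fnorm big_ord0.
(* As [F] gains one degree, applied to the part of [u] below [d] it already yields the part below
   [d.+1]. The truncation has the same norm at [d.+1] as at [d], where the induction hypothesis
   bounds it. *)
pose w k := trd d (u k).
have wc : centered w by move=> k; rewrite /w trdE uc if_same.
rewrite -{1}Fu (@fnorm_eqd _ _ nr d.+1 r _ (F w i)); last first.
  by apply: F_contract => // k; exact: eqd_trd.
apply: H => // k; apply: (le_trans _ (IH k)).
rewrite (fnorm_eqd nr r (@eqd_trd _ d (u k))) -/(w k) fnormS big1 ?addr0 // => l _.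
by rewrite /w trdE; case: ifP => [|_]; [have := ltn_ord l; lia|rewrite (nr0 nrP) mul0r].
Qed.

End FixedPoint.

(** * Inverse function theorem and conjugacy *)

Section InverseFunction.
Variables (K : numFieldType) (R : realType) (nr : K -> R).
Hypothesis nrP : absolute_value nr.
Implicit Types (a b p q s t : fps K).

Lemma coef10_comp a p q : p 0%N 0%N = 0 -> q 0%N 0%N = 0 ->
  fcomp a p q 1%N 0%N = a 1%N 0%N * p 1%N 0%N + a 0%N 1%N * q 1%N 0%N.
Proof.
move=> p0 q0; move/(congr1 (fun a : fps K => a 0%N 0%N)): (dX_comp p0 q0 a).
by rewrite coefDf !coef00M !coef00_comp.
Qed.
Lemma coef01_comp a p q : p 0%N 0%N = 0 -> q 0%N 0%N = 0 ->
  fcomp a p q 0%N 1%N = a 1%N 0%N * p 0%N 1%N + a 0%N 1%N * q 0%N 1%N.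
Proof.
move=> p0 q0; move/(congr1 (fun a : fps K => a 0%N 0%N)): (dY_comp p0 q0 a).
by rewrite coefDf !coef00M !coef00_comp.
Qed.

Definition jac p q := p 1%N 0%N * q 0%N 1%N - p 0%N 1%N * q 1%N 0%N.

Lemma jac_comp p q s t : s 0%N 0%N = 0 -> t 0%N 0%N = 0 ->
  jac (fcomp p s t) (fcomp q s t) = jac p q * jac s t.
Proof. by move=> s0 t0; rewrite /jac !coef10_comp // !coef01_comp //; ring. Qed.

Lemma jac_XY : jac (fX K) (fY K) = 1.
Proof. by rewrite /jac !coefXE !coefYE /=; ring. Qed.

Lemma split_linear p : p 0%N 0%N = 0 -> analytic nr p ->
  exists A B, [/\ analytic nr A, analytic nr B, A 0%N 0%N = 0, B 0%N 0%N = 0 &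
  p = fcst (p 1%N 0%N) * fX K + fcst (p 0%N 1%N) * fY K + (fX K * A + fY K * B)].
Proof.
move=> p0 Hp; exists (shX p - fcst (p 1%N 0%N)), (shY0 p - fcst (p 0%N 1%N)); split.
- by apply: analyticB => //; [exact: analytic_shX|exact: analyticC].
- by apply: analyticB => //; [exact: analytic_shY0|exact: analyticC].
- by rewrite coefBf coefCf /= subrr.
- by rewrite coefBf coefCf /= subrr.
- by rewrite {1}(fps_split p) p0 fcst0; ring.
Qed.

(** Splitting off the linear parts turns the equations into [(s, t) = M (x - p2, y - q2)], with [M]
    the inverse Jacobian matrix. The remainders are sums of products of two series without constant
    term, hence gain a degree, and [fixed_point] applies. *)
Lemma right_inverse p q : analytic nr p -> analytic nr q ->
  p 0%N 0%N = 0 -> q 0%N 0%N = 0 -> jac p q != 0 ->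
  exists s t, [/\ analytic nr s, analytic nr t, s 0%N 0%N = 0, t 0%N 0%N = 0 &
    fcomp p s t = fX K /\ fcomp q s t = fY K].
Proof.
move=> Hp Hq p0 q0 J0.
have [A [B [HA HB A0 B0 Ep]]] := split_linear p0 Hp.
have [A' [B' [HA' HB' A0' B0' Eq]]] := split_linear q0 Hq.
set D := jac p q in J0.
set p10 := p 1%N 0%N in Ep; set p01 := p 0%N 1%N in Ep.
set q10 := q 1%N 0%N in Eq; set q01 := q 0%N 1%N in Eq.
have DE : D = p10 * q01 - p01 * q10 by [].
(* The inverse Jacobian matrix at the origin; [true] indexes the first coordinate. *)
pose m (b c : bool) : K := (if b then (if c then q01 else - p01) else
                              (if c then - q10 else p10)) / D.
pose p2 (u : bool -> fps K) :=
  u true * fcomp A (u true) (u false) + u false * fcomp B (u true) (u false).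
pose q2 (u : bool -> fps K) :=
  u true * fcomp A' (u true) (u false) + u false * fcomp B' (u true) (u false).
pose F u (b : bool) : fps K := fcst (m b true) * (fX K - p2 u) + fcst (m b false) * (fY K - q2 u).
have [u [uc Fu Hu]] : exists u, [/\ centered u, F u = u &
  forall (R : realType) (nr : K -> R) (r e : R), absolute_value nr -> 0 <= r -> 0 <= e ->
    (forall d w, centered w -> (forall i, fnorm nr d r (w i) <= e) ->
       forall i, fnorm nr d r (F w i) <= e) ->
    forall i, bounded_at nr r e (u i)].
  apply: fixed_point.
    move=> u uc i; rewrite /F /p2 /q2 coefDf !coef00M !coefBf !coefDf !coef00M !uc.
    by rewrite coefXE coefYE /= !mul0r !addr0 subrr !mulr0 addr0.
  move=> d u v uc vc E i; rewrite /F.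
  have key (G : fps K) (b : bool) : G 0%N 0%N = 0 ->
      eqd d.+1 (u b * fcomp G (u true) (u false)) (v b * fcomp G (v true) (v false)).
    move=> G0; apply: (@eqd_trans _ _ (u b * fcomp G (v true) (v false))).
      by apply: eqd1M; [exact: uc|apply: fcomp_eqd_args; rewrite ?uc ?vc].
    by rewrite ![_ * fcomp G _ _]mulrC; apply: eqd1M; rewrite ?coef00_comp.
  by apply: eqdD; apply: eqdM => //; apply: eqdB => //; apply: eqdD; exact: key.
pose s := u true; pose t := u false.
have Es : s = fcst (m true true) * (fX K - p2 u) + fcst (m true false) * (fY K - q2 u).
  by rewrite /s -{1}Fu.
have Et : t = fcst (m false true) * (fX K - p2 u) + fcst (m false false) * (fY K - q2 u).
  by rewrite /t -{1}Fu.
have s0 : s 0%N 0%N = 0 := uc true.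
have t0 : t 0%N 0%N = 0 := uc false.
have an (b : bool) : analytic nr (u b).
  pose k : R := 1 + \sum_(b : bool) \sum_(c : bool) nr (m b c).
  have kb (b' c : bool) : nr (m b' c) <= k.
    have H (x y : bool) := nr_ge0 nrP (m x y); rewrite /k !big_bool.
    move: (H true true) (H true false) (H false true) (H false false).
    by case: b' c => -[] /=; lra.
  have k0 : 0 < k.
    rewrite /k ltr_pwDl // sumr_ge0 // => *; apply: sumr_ge0 => *; exact: (nr_ge0 nrP).
  (* The constants make the ball of radius [e] stable: at radius [e / (4 * k)] each of [x - p2] and
     [y - q2] is at most [e / (4 * k) + 2 * e / (8 * k) = e / (2 * k)], and the two entries of a row
     of [m], each at most [k], bring this back to [e]. *)
  have tau0 : 0 < 1 / (8 * k) by rewrite divr_gt0 // mulr_gt0.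
  have [r1 r10 b1] := small_radius nrP HA A0 tau0.
  have [r2 r20 b2] := small_radius nrP HB B0 tau0.
  have [r3 r30 b3] := small_radius nrP HA' A0' tau0.
  have [r4 r40 b4] := small_radius nrP HB' B0' tau0.
  pose e := Num.min (Num.min r1 r2) (Num.min r3 r4).
  have e0 : 0 < e by rewrite !lt_min r10 r20 r30.
  have r0 : 0 < e / (4 * k) by rewrite divr_gt0 // mulr_gt0.
  have bd r' C G : e <= r' -> bounded_at nr r' C G -> bounded_at nr e C G.
    by move=> L; apply: (bounded_at_le nrP) => //; exact: ltW.
  have {}b1 := bd _ _ _ _ b1; have {}b2 := bd _ _ _ _ b2.
  have {}b3 := bd _ _ _ _ b3; have {}b4 := bd _ _ _ _ b4.
  exists (e / (4 * k)), e; split=> //.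
  apply: Hu => //; [exact: ltW|exact: ltW|].
  move=> d w wc wb i.
  have key (G : fps K) (b' : bool) : bounded_at nr e (1 / (8 * k)) G ->
      fnorm nr d (e / (4 * k)) (w b' * fcomp G (w true) (w false)) <= e * (1 / (8 * k)).
    move=> bG; apply: (fnormMle nrP) => //; first exact: ltW.
    apply: (le_trans _ (bG d)).
    by apply: (fnorm_comp nrP) => //; exact: ltW.
  have key2 (Z G H : fps K) : fnorm nr d (e / (4 * k)) Z <= e / (4 * k) ->
      bounded_at nr e (1 / (8 * k)) G -> bounded_at nr e (1 / (8 * k)) H ->
      fnorm nr d (e / (4 * k)) (Z - (w true * fcomp G (w true) (w false) +
         w false * fcomp H (w true) (w false))) <= e / (2 * k).
    move=> LZ bG bH; apply: (le_trans (fnormD nrP _ _ _ (ltW r0))).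
    rewrite (fnormN nrP).
    apply: (@le_trans _ _ (e / (4 * k) + (e * (1 / (8 * k)) + e * (1 / (8 * k))))).
      apply: lerD => //; apply: (le_trans (fnormD nrP _ _ _ (ltW r0))).
      by apply: lerD; apply: key.
    rewrite le_eqVlt; apply/orP; left; apply/eqP; field; exact: lt0r_neq0.
  rewrite /F; apply: (le_trans (fnormD nrP _ _ _ (ltW r0))); rewrite !(fnormCM nrP).
  rewrite [X in _ <= X](_ : e = k * (e / (2 * k)) + k * (e / (2 * k))); last first.
    by field; exact: lt0r_neq0.
  have e2 : 0 <= e / (2 * k) by rewrite ltW // divr_gt0 // mulr_gt0.
  apply: lerD; apply: ler_pM; rewrite ?(nr_ge0 nrP) ?(fnorm_ge0 nrP) ?(ltW r0) ?kb //.
    apply: key2; first by apply: (fnorm_X nrP); exact: ltW.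
      by apply: b1; rewrite /e !ge_min lexx.
    by apply: b2; rewrite /e !ge_min lexx orbT.
  apply: key2; first by apply: (fnorm_Y nrP); exact: ltW.
    by apply: b3; rewrite /e !ge_min lexx ?orbT.
  by apply: b4; rewrite /e !ge_min lexx ?orbT.
exists s, t; split; [exact: an|exact: an|exact: s0|exact: t0|].
have M1 : fcst p10 * fcst (m true true) + fcst p01 * fcst (m false true) = 1.
  by rewrite -!fcstM -fcstD -fcst1; congr fcst; rewrite /m DE; field; rewrite -DE.
have M2 : fcst p10 * fcst (m true false) + fcst p01 * fcst (m false false) = 0.
  by rewrite -!fcstM -fcstD -fcst0; congr fcst; rewrite /m DE; field; rewrite -DE.
have M3 : fcst q10 * fcst (m true true) + fcst q01 * fcst (m false true) = 0.
  by rewrite -!fcstM -fcstD -fcst0; congr fcst; rewrite /m DE; field; rewrite -DE.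
have M4 : fcst q10 * fcst (m true false) + fcst q01 * fcst (m false false) = 1.
  by rewrite -!fcstM -fcstD -fcst1; congr fcst; rewrite /m DE; field; rewrite -DE.
split.
  rewrite Ep !fcompD // !fcompCM // !fcompXM // !fcompYM // fcompX // fcompY //.
  rewrite -/(p2 u); move: (p2 u) (q2 u) Es Et => x y -> ->.
  transitivity ((fcst p10 * fcst (m true true) + fcst p01 * fcst (m false true)) * (fX K - x)
    + (fcst p10 * fcst (m true false) + fcst p01 * fcst (m false false)) * (fY K - y) + x).
    by ring.
  by rewrite M1 M2; ring.
rewrite Eq !fcompD // !fcompCM // !fcompXM // !fcompYM // fcompX // fcompY //.
rewrite -/(q2 u); move: (p2 u) (q2 u) Es Et => x y -> ->.
transitivity ((fcst q10 * fcst (m true true) + fcst q01 * fcst (m false true)) * (fX K - x)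
  + (fcst q10 * fcst (m true false) + fcst q01 * fcst (m false false)) * (fY K - y) + y).
  by ring.
by rewrite M3 M4; ring.
Qed.

(** The right inverse has a right inverse of its own, and associativity of composition identifies
    the latter with [(p, q)]. *)
Lemma inverse_function p q : analytic nr p -> analytic nr q ->
  p 0%N 0%N = 0 -> q 0%N 0%N = 0 -> jac p q != 0 ->
  exists s t, [/\ analytic nr s, analytic nr t, s 0%N 0%N = 0 & t 0%N 0%N = 0] /\
    [/\ jac s t != 0, fcomp p s t = fX K, fcomp q s t = fY K,
        fcomp s p q = fX K & fcomp t p q = fY K].
Proof.
move=> Hp Hq p0 q0 J0; have [s [t [Hs Ht s0 t0 [E1 E2]]]] := right_inverse Hp Hq p0 q0 J0.
have J1 : jac s t != 0.
  move: (jac_comp p q s0 t0); rewrite E1 E2 jac_XY.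
  by apply: contra_eq_neq => ->; rewrite mulr0 oner_eq0.
have [p' [q' [_ _ p0' q0' [E3 E4]]]] := right_inverse Hs Ht s0 t0 J1.
have Ep : p' = p by rewrite -[RHS]fcomp_id -E3 -E4 -fcompA // E1 fcompX.
have Eq : q' = q by rewrite -[RHS]fcomp_id -E3 -E4 -fcompA // E2 fcompY.
by exists s, t; split=> //; split=> //; rewrite -Ep -Eq.
Qed.

End InverseFunction.

(** * Conjugacy of foliations as an equivalence relation *)

Section Conjugacy.
Variables (K : numFieldType) (R : realType) (nr : K -> R).

(** Isolates the link with the topology of the coefficient field: convergence as in the statement
    amounts to bounded truncated norms. *)
Record analytic_field : Prop := AnalyticField {
  af_abs : absolute_value nr;
  af_conv2 : forall a : series2 K, convergent2 a <-> analytic nr a;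
  af_conv1 : forall f : series1 K, convergent1 f <-> analytic nr (sliftY f) }.

Hypothesis afP : analytic_field.
Let nrP := af_abs afP.
Implicit Types (a b p q s t u : fps K) (X Y Z : vfield K).

Definition flie X p : fps K := (vfX X : fps K) * dX p + (vfY X : fps K) * dY p.

Lemma flie_comp X a p q : p 0%N 0%N = 0 -> q 0%N 0%N = 0 ->
  flie X (fcomp a p q) = fcomp (dX a) p q * flie X p + fcomp (dY a) p q * flie X q.
Proof. by move=> p0 q0; rewrite /flie dX_comp // dY_comp //; ring. Qed.

Lemma flie_X X : flie X (fX K) = vfX X.
Proof. by rewrite /flie dX_X dY_X mulr0 addr0 mulr1. Qed.
Lemma flie_Y X : flie X (fY K) = vfY X.
Proof. by rewrite /flie dX_Y dY_Y mulr0 add0r mulr1. Qed.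

(** The equations, given for the two coordinates only, extend to every function of them; this is
    what lets conjugacies be composed and inverted. *)
Lemma flie_conjugate X Y p q u a : p 0%N 0%N = 0 -> q 0%N 0%N = 0 ->
  flie X p = u * fcomp (vfX Y) p q -> flie X q = u * fcomp (vfY Y) p q ->
  flie X (fcomp a p q) = u * fcomp (flie Y a) p q.
Proof.
move=> p0 q0 E1 E2; rewrite flie_comp // E1 E2 /flie fcompD // !fcompM //; ring.
Qed.

Lemma conjugateP X Y : conjugate_to X Y <-> exists p q u,
  [/\ analytic nr p, analytic nr q, p 0%N 0%N = 0, q 0%N 0%N = 0 & jac p q != 0] /\
  [/\ analytic nr u, u 0%N 0%N != 0, flie X p = u * fcomp (vfX Y) p q &
     flie X q = u * fcomp (vfY Y) p q].
Proof.
split.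
  move=> [p [q [u [[/(af_conv2 afP) Hp /(af_conv2 afP) Hq p0 q0 J0]]]]].
  move=> [/(af_conv2 afP) Hu u0] E1 E2; exists p, q, u; split; split=> //.
    by apply: fps_ext => i j; exact: E1.
  by apply: fps_ext => i j; exact: E2.
move=> [p [q [u [[Hp Hq p0 q0 J0] [Hu u0 E1 E2]]]]]; exists p, q, u; split.
- by split=> //; apply/(af_conv2 afP).
- by split=> //; apply/(af_conv2 afP).
- by move=> i j; move/(congr1 (fun a : fps K => a i j)): E1.
- by move=> i j; move/(congr1 (fun a : fps K => a i j)): E2.
Qed.

Lemma conjugate_trans X Y Z : conjugate_to X Y -> conjugate_to Y Z -> conjugate_to X Z.
Proof.
move=> /conjugateP [p [q [u [[Hp Hq p0 q0 J0] [Hu u0 E1 E2]]]]].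
move=> /conjugateP [P [Q [U [[HP HQ P0 Q0 J1] [HU U0 E3 E4]]]]].
apply/conjugateP; exists (fcomp P p q), (fcomp Q p q), (u * fcomp U p q).
have Ed a := flie_conjugate a p0 q0 E1 E2.
split; split.
- exact: (analytic_comp nrP).
- exact: (analytic_comp nrP).
- by rewrite coef00_comp.
- by rewrite coef00_comp.
- by rewrite jac_comp // mulf_neq0.
- by apply: (analyticM nrP) => //; exact: (analytic_comp nrP).
- by rewrite coef00M coef00_comp mulf_neq0.
- by rewrite Ed E3 fcompM // fcompA // mulrA.
- by rewrite Ed E4 fcompM // fcompA // mulrA.
Qed.

Lemma conjugate_sym X Y : conjugate_to X Y -> conjugate_to Y X.
Proof.
move=> /conjugateP [p [q [u [[Hp Hq p0 q0 J0] [Hu u0 E1 E2]]]]].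
have [s [t [[Hs Ht s0 t0] [J1 C1 C2 C3 C4]]]] := inverse_function nrP Hp Hq p0 q0 J0.
have Ed a := flie_conjugate a p0 q0 E1 E2.
have iu : finv u 0%N 0%N != 0 by apply: finv_neq0.
have key a w : flie X (fcomp a p q) = w -> flie Y a = fcomp (finv u) s t * fcomp w s t.
  move=> <-; rewrite Ed -fcompM // mulrA [finv u * u]mulrC finvP // mul1r.
  by rewrite fcompA // C1 C2 fcomp_id.
apply/conjugateP; exists s, t, (fcomp (finv u) s t); split; split=> //.
- by apply: (analytic_comp nrP) => //; exact: (analytic_finv nrP).
- by rewrite coef00_comp.
- by apply: key; rewrite C3 flie_X.
- by apply: key; rewrite C4 flie_Y.
Qed.

End Conjugacy.

(** * Flow box, welding and blow-up *)

Section FormalWelding.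
Variables (K : numFieldType) (R : realType) (nr : K -> R).
Hypothesis nrP : absolute_value nr.
Implicit Types a b p q : fps K.

Lemma bounded_coef r C a i j : 0 < r -> bounded_at nr r C a ->
  nr (a i j) <= C / r ^+ (i + j).
Proof.
move=> r0 Ba; rewrite ler_pdivlMr ?exprn_gt0 //; apply: (le_trans _ (Ba (i + j).+1)).
rewrite fnormS ler_wpDl ?(fnorm_ge0 nrP) ?(ltW r0) //.
have Hi : (i < (i + j).+1)%N by rewrite ltnS leq_addr.
rewrite (bigD1 (Ordinal Hi)) //= addKn lerDl sumr_ge0 // => k _.
by rewrite mulr_ge0 ?(nr_ge0 nrP) ?exprn_ge0 ?(ltW r0).
Qed.

(** At radius [1 / (4 * s)] the [d + 1] monomials of degree [d] weigh at most
    [C * (d + 1) / 4 ^ d <= C / 2 ^ d], the terms of a geometric series. *)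
Lemma analytic_coef (C s : R) a : 0 < s -> (forall i j, nr (a i j) <= C * s ^+ (i + j)) ->
  analytic nr a.
Proof.
move=> s0 H; have C0 : 0 <= C.
  by apply: (le_trans (nr_ge0 nrP (a 0%N 0%N))); move: (H 0%N 0%N); rewrite expr0 mulr1.
exists (1 / (4 * s)), (C * 2); split; first by rewrite divr_gt0 // mulr_gt0.
move=> d; suff L : fnorm nr d (1 / (4 * s)) a <= C * (2 - 2 * (1 / 2) ^+ d).
  apply: (le_trans L); apply: ler_wpM2l => //.
  by rewrite lerBlDr lerDl mulr_ge0 // exprn_ge0 // divr_ge0.
elim: d => [|d IH]; first by rewrite /fnorm big_ord0 expr0 mulr1 subrr mulr0.
rewrite fnormS; apply: (@le_trans _ _ (C * (2 - 2 * (1 / 2) ^+ d) + C * (1 / 2) ^+ d)).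
  apply: lerD => //; apply: (@le_trans _ _ (\sum_(i < d.+1) C * (1 / 4) ^+ d)).
    apply: ler_sum => i _; apply: (@le_trans _ _ (C * s ^+ d * (1 / (4 * s)) ^+ d)).
      apply: ler_wpM2r; first by rewrite exprn_ge0 // divr_ge0 // mulr_ge0 // ltW.
      by apply: (le_trans (H _ _)); rewrite subnKC // -ltnS.
    rewrite -mulrA -exprMn (_ : s * _ = 1 / 4) //; field; exact: lt0r_neq0.
  rewrite sumr_const card_ord -[_ *+ d.+1]mulr_natr -mulrA; apply: ler_wpM2l => //.
  rewrite (_ : 1 / 4 = (1 / 2) * (1 / 2) :> R); last by field.
  rewrite exprMn -mulrA ler_piMr ?exprn_ge0 ?divr_ge0 // expr_div_n expr1n mul1r mulrC.
  by rewrite ler_pdivrMr ?exprn_gt0 // mul1r -natrX ler_nat ltn_expl.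
by rewrite -mulrDr exprS; apply: ler_wpM2l => //; lra.
Qed.

Lemma fnorm_finv1 d r a : 0 <= r -> a 0%N 0%N = 0 -> fnorm nr d r a <= 1 / 2 ->
  fnorm nr d r (finv1 a) <= 2.
Proof.
move=> r0 a0 La; apply: (le_trans _ (bounded_geom nrP d)).
apply: (fnorm_comp nrP) => //; rewrite (fnorm0 nrP); lra.
Qed.

Lemma finv1_eqd d a b : a 0%N 0%N = 0 -> b 0%N 0%N = 0 -> eqd d a b ->
  eqd d (finv1 a) (finv1 b).
Proof. by move=> a0 b0 E; apply: fcomp_eqd_args. Qed.

(** [(1/y)] times the primitive in [y] vanishing at [y = 0]. *)
Definition primY a : fps K := fun i j => a i j / j.+1%:R.

Lemma dY_primY a : dY (fY K * primY a) = a.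
Proof.
apply: fps_ext => i j; rewrite /dY /sderivY coefYM /primY -[LHS]mulr_natr divfK //.
Qed.
Lemma primY_eqd d a b : eqd d a b -> eqd d (primY a) (primY b).
Proof. by move=> E i j L; rewrite /primY E. Qed.
Lemma primY_dom a i j : nr (primY a i j) <= nr (a i j).
Proof.
rewrite /primY (nrM nrP) (nrV nrP) ?pnatr_eq0 // (nr_nat nrP).
by rewrite ler_piMr ?(nr_ge0 nrP) // invf_le1 ?ltr0n // ler1n.
Qed.
Lemma fnorm_primY d r a : 0 <= r -> fnorm nr d r (primY a) <= fnorm nr d r a.
Proof. by move=> r0; apply: (fnorm_dom nrP) => // i j _; exact: primY_dom. Qed.

Lemma coef01M a b : (a * b) 0%N 1%N = a 0%N 1%N * b 0%N 0%N + a 0%N 0%N * b 0%N 1%N.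
Proof.
move/(congr1 (fun a : fps K => a 0%N 0%N)): (dYM a b).
by rewrite coefDf !coef00M.
Qed.
Lemma coef10M a b : (a * b) 1%N 0%N = a 1%N 0%N * b 0%N 0%N + a 0%N 0%N * b 1%N 0%N.
Proof.
move/(congr1 (fun a : fps K => a 0%N 0%N)): (dXM a b).
by rewrite coefDf !coef00M.
Qed.

Lemma bounded_at_comp d r e C a p q : 0 <= r -> p 0%N 0%N = 0 -> q 0%N 0%N = 0 ->
  fnorm nr d r p <= e -> fnorm nr d r q <= e -> bounded_at nr e C a ->
  fnorm nr d r (fcomp a p q) <= C.
Proof. by move=> r0 p0 q0 Lp Lq Ba; apply: le_trans (fnorm_comp nrP _ r0 p0 q0 Lp Lq) (Ba d). Qed.

(** The solution [x = t * (1 + t * z * chi)] of [dx/dz = x^2 * ga(x, z)] with [x = t] at [z = 0]. *)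
Lemma flow_box ga : analytic nr ga -> exists chi,
  [/\ analytic nr chi, chi 0%N 0%N = ga 0%N 0%N &
   let w := 1 + fX K * (fY K * chi) in
   dY w = fX K * (w ^+ 2 * fcomp ga (fX K * w) (fY K))].
Proof.
move=> Hga; have X00 : fX K 0%N 0%N = 0 by rewrite coefXE.
have Y00 : fY K 0%N 0%N = 0 by rewrite coefYE.
(* The variables are now [t] and [z]. For [x = t * w] and [w = 1 + om] the equation reads
   [dw/dz = t * w^2 * ga(t * w, z)]; after integration in [z] the factor [t] gives the
   contraction. *)
pose G om := (1 + om) ^+ 2 * fcomp ga (fX K * (1 + om)) (fY K).
pose F (U : unit -> fps K) (i : unit) := fX K * (fY K * primY (G (U i))).
have X0 a : (fX K * a) 0%N 0%N = 0 by rewrite coef00M X00 mul0r.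
have Fc (U V : unit -> fps K) d : centered U -> centered V ->
    (forall i, eqd d (U i) (V i)) -> forall i, eqd d.+1 (F U i) (F V i).
  move=> Uc Vc E i; rewrite /F; apply: eqd1M => //; apply: eqdM => //; apply: primY_eqd.
  apply: eqdM; first by apply: eqdX; apply: eqdD.
  by apply: fcomp_eqd_args => //; apply: eqdM => //; exact: eqdD.
have [u [uc Fu Hu]] := @fixed_point K unit F (fun U _ i => X0 _) (fun d U V => @Fc U V d).
pose om := u tt; have Eom : om = fX K * (fY K * primY (G om)) by rewrite /om -{1}Fu.
have an : analytic nr om.
  have [s [C [s0 C1 Bs _]]] := analytic2 nrP Hga Hga.
  have C0 : 0 < C by rewrite (lt_le_trans _ C1).
  (* With [om] in the unit ball, [w] has norm at most 2: [s / 2] keeps [t * w] within the radius of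
     [ga], and [4 * C] is the resulting bound on [G]. *)
  pose r := Num.min (s / 2) (Num.min 1 (1 / (4 * C))).
  have r0 : 0 < r by rewrite !lt_min ltr01 !divr_gt0 // mulr_gt0.
  have r0' := ltW r0.
  have r1 : r <= 1 by rewrite /r !ge_min lexx !orbT.
  have rC : r * (4 * C) <= 1.
    by rewrite -ler_pdivlMr ?mulr_gt0 // /r !ge_min lexx !orbT.
  have rs : r * 2 <= s by rewrite -ler_pdivlMr // /r !ge_min lexx.
  exists r, 1; split=> //; apply: Hu => // d w wc Lw i.
  have L2 : fnorm nr d r (1 + w i) <= 2.
    apply: (le_trans (fnormD nrP _ _ _ r0')); rewrite (_ : 2 = 1 + 1 :> R); last by ring.
    by apply: lerD => //; exact: (fnorm1 nrP).
  have LX : fnorm nr d r (fX K * (1 + w i)) <= s.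
    by apply: le_trans rs; apply: (fnormMle nrP) => //; exact: (fnorm_X nrP).
  have LY : fnorm nr d r (fY K) <= s.
    by apply: (le_trans (fnorm_Y nrP _ r0')); apply: le_trans rs; rewrite ler_peMr // ler1n.
  have LG : fnorm nr d r (G (w i)) <= 2 ^+ 2 * C.
    apply: (fnormMle nrP) => //; first exact: (fnormXle nrP).
    exact: (bounded_at_comp _ _ _ LX LY Bs).
  rewrite /F; apply: (@le_trans _ _ (r * (r * (2 ^+ 2 * C)))).
    apply: (fnormMle nrP) => //; first exact: (fnorm_X nrP).
    apply: (fnormMle nrP) => //; first exact: (fnorm_Y nrP).
    exact: le_trans (fnorm_primY _ _ r0') LG.
  rewrite (_ : r * _ = r * (r * (4 * C))); last by ring.
  by apply: mulr_ile1 => //; rewrite !mulr_ge0 // ltW.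
have Eg : fX K * (fY K * primY (G om)) = om by rewrite -Eom.
have om0 : om 0%N 0%N = 0 by rewrite Eom.
exists (primY (G om)); split.
- apply: (analytic_dom nrP (primY_dom _)); apply: (analyticM nrP).
    by apply: (analyticXn nrP); apply: (analyticD nrP) => //; exact: (analytic1 nrP).
  apply: (analytic_comp nrP) => //; last exact: (analyticY nrP).
  apply: (analyticM nrP); first exact: (analyticX nrP).
  by apply: (analyticD nrP) => //; exact: (analytic1 nrP).
- rewrite /primY divr1 /G coef00M coef00_comp // coef00X coefDf om0 coef1f.
  by rewrite addr0 expr1n mul1r.
- by rewrite /= Eg dYD -fcst1 dYC add0r {1}Eom dYX dY_primY /G.
Qed.

(** Since [X = xi] and [Y = y / xi], the monomial [X^i Y^j] is [xi^(i - j) y^j]: these are the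
    series without positive powers of [xi]. *)
Definition under a := forall i j, (j < i)%N -> a i j = 0.

Definition proj_over a : fps K := fun i j => if (j < i)%N then a i j else 0.
Definition proj_under a : fps K := fun i j => if (j < i)%N then 0 else a i j.

Lemma proj_split a : a = proj_over a + proj_under a.
Proof.
by apply: fps_ext => i j; rewrite coefDf /proj_over /proj_under; case: ifP; rewrite ?addr0 ?add0r.
Qed.
Lemma proj_over_eqd d a b : eqd d a b -> eqd d (proj_over a) (proj_over b).
Proof. by move=> E i j L; rewrite /proj_over E. Qed.
Lemma proj_under_eqd d a b : eqd d a b -> eqd d (proj_under a) (proj_under b).
Proof. by move=> E i j L; rewrite /proj_under E. Qed.
Lemma proj_over_dom a i j : nr (proj_over a i j) <= nr (a i j).
Proof. by rewrite /proj_over; case: ifP => // _; rewrite (nr0 nrP) (nr_ge0 nrP). Qed.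
Lemma proj_under_dom a i j : nr (proj_under a i j) <= nr (a i j).
Proof. by rewrite /proj_under; case: ifP => // _; rewrite (nr0 nrP) (nr_ge0 nrP). Qed.

(** The welding equation: [x = t * (1 + t * z * chi(t, z))] with [x = X * (1 + v)],
    [t = X * (1 + tau)] and [x * z = X * Y]. *)
Lemma weld chi : analytic nr chi -> exists v tau,
  [/\ analytic nr v, analytic nr tau, forall i j, (i <= j)%N -> v i j = 0 & under tau] /\
  [/\ forall j, tau 0%N j = 0, tau 1%N 1%N = - chi 0%N 0%N &
   1 + v = (1 + tau) * (1 + fX K * (1 + tau) * (fY K * finv1 v *
              fcomp chi (fX K * (1 + tau)) (fY K * finv1 v)))].
Proof.
move=> Hchi; have X00 : fX K 0%N 0%N = 0 by rewrite coefXE.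
have Y00 : fY K 0%N 0%N = 0 by rewrite coefYE.
have X0 a : (fX K * a) 0%N 0%N = 0 by rewrite coef00M X00 mul0r.
have Y0 a : (fY K * a) 0%N 0%N = 0 by rewrite coef00M Y00 mul0r.
(* The single unknown is [s = v - tau], from which [v] and [tau] are recovered by projection.
   Expanding the product in the welding equation turns it into the additive splitting problem
   [s = X * Y * G s]. *)
pose T s := 1 - proj_under s; pose Vi s := finv1 (proj_over s).
pose G s := T s ^+ 2 * (Vi s * fcomp chi (fX K * T s) (fY K * Vi s)).
pose F (U : unit -> fps K) (i : unit) := fX K * (fY K * G (U i)).
have Fc (U V : unit -> fps K) d : centered U -> centered V ->
    (forall i, eqd d (U i) (V i)) -> forall i, eqd d.+1 (F U i) (F V i).
  move=> Uc Vc E i; rewrite /F; apply: eqd1M => //.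
  have ET : eqd d (T (U i)) (T (V i)) by apply: eqdB => //; apply: proj_under_eqd.
  have EV : eqd d (Vi (U i)) (Vi (V i)) by apply: finv1_eqd => //; apply: proj_over_eqd.
  apply: eqdM => //; apply: eqdM; first exact: eqdX.
  by apply: eqdM => //; apply: fcomp_eqd_args => //; apply: eqdM.
have [u [uc Fu Hu]] := @fixed_point K unit F (fun U _ i => X0 _) (fun d U V => @Fc U V d).
pose si := u tt; have Esi : si = fX K * (fY K * G si) by rewrite /si -{1}Fu.
have an : analytic nr si.
  have [s [C [s0 C1 Bs _]]] := analytic2 nrP Hchi Hchi.
  have C0 : 0 < C by rewrite (lt_le_trans _ C1).
  (* The ball has radius 1/2 because [1 / (1 + v)] is then bounded by 2; [16 * C] is twice the bound
     [2 ^+ 2 * (2 * C)] on [G]. *)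
  pose r := Num.min (s / 2) (Num.min 1 (1 / (16 * C))).
  have r0 : 0 < r by rewrite !lt_min ltr01 !divr_gt0 // mulr_gt0.
  have r0' := ltW r0.
  have r1 : r <= 1 by rewrite /r !ge_min lexx !orbT.
  have rC : r * (16 * C) <= 1.
    by rewrite -ler_pdivlMr ?mulr_gt0 // /r !ge_min lexx !orbT.
  have rs : r * 2 <= s by rewrite -ler_pdivlMr // /r !ge_min lexx.
  exists r, (1 / 2); split=> //; apply: Hu => // d w wc Lw i.
  have LT : fnorm nr d r (T (w i)) <= 2.
    apply: (le_trans (fnormD nrP _ _ _ r0')); rewrite (fnormN nrP).
    apply: (@le_trans _ _ (1 + 1 / 2)); last lra.
    apply: lerD => //; first exact: (fnorm1 nrP).
    by apply: le_trans (Lw i); apply: (fnorm_dom nrP) => // k l _; exact: proj_under_dom.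
  have LV : fnorm nr d r (Vi (w i)) <= 2.
    apply: fnorm_finv1 => //.
    by apply: le_trans (Lw i); apply: (fnorm_dom nrP) => // k l _; exact: proj_over_dom.
  have LX : fnorm nr d r (fX K * T (w i)) <= s.
    by apply: le_trans rs; apply: (fnormMle nrP) => //; exact: (fnorm_X nrP).
  have LY : fnorm nr d r (fY K * Vi (w i)) <= s.
    by apply: le_trans rs; apply: (fnormMle nrP) => //; exact: (fnorm_Y nrP).
  have LG : fnorm nr d r (G (w i)) <= 2 ^+ 2 * (2 * C).
    apply: (fnormMle nrP) => //; first exact: (fnormXle nrP).
    apply: (fnormMle nrP) => //; exact: (bounded_at_comp _ _ _ LX LY Bs).
  rewrite /F; apply: (@le_trans _ _ (r * (r * (2 ^+ 2 * (2 * C))))).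
    apply: (fnormMle nrP) => //; first exact: (fnorm_X nrP).
    by apply: (fnormMle nrP) => //; exact: (fnorm_Y nrP).
  rewrite (_ : r * _ = r * (r * (16 * C)) * (1 / 2)); last by field.
  rewrite -[X in _ <= X]mul1r; apply: ler_wpM2r; first lra.
  by apply: mulr_ile1 => //; rewrite !mulr_ge0 // ltW.
have si0 j : si 0%N j = 0 by rewrite Esi coefXM.
have si00 : proj_over si 0%N 0%N = 0 by [].
exists (proj_over si), (- proj_under si); split; split.
- exact: (analytic_dom nrP (proj_over_dom _)).
- by apply: (analyticN nrP); apply: (analytic_dom nrP (proj_under_dom _)).
- by move=> i j L; rewrite /proj_over ltnNge L.
- by move=> i j L; rewrite coefNf /proj_under L oppr0.
- by move=> j; rewrite coefNf /proj_under /= si0 oppr0.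
- rewrite coefNf /proj_under /= {1}Esi coefXM coefYM; congr (- _).
  rewrite /G !coef00M coef00_comp //= coef00X /T coefBf coef1f /proj_under /= si0 subr0.
  by rewrite expr1n mul1r /Vi /finv1 coef00_comp // mul1r.
- rewrite -/(T si) -/(Vi si) {1}(_ : proj_over si = si - proj_under si).
    rewrite addrC -addrA [- _ + _]addrC -/(T si) {1}Esi /G; ring.
  by rewrite {2}(proj_split si) addrK.
Qed.

Lemma underM a b : under a -> under b -> under (a * b).
Proof.
move=> Ha Hb i j L; rewrite coefMf big1 // => m _; rewrite big1 // => n _.
have [L1|L1] := ltnP n m; first by rewrite Ha // mul0r.
have [L2|L2] := ltnP (j - n) (i - m); first by rewrite Hb // mulr0.
by have := ltn_ord m; have := ltn_ord n; lia.
Qed.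
Lemma underC c : under (fcst c).
Proof. by move=> [|i] j. Qed.
Lemma underD a b : under a -> under b -> under (a + b).
Proof. by move=> Ha Hb i j L; rewrite coefDf Ha // Hb // addr0. Qed.
Lemma underN a : under a -> under (- a).
Proof. by move=> Ha i j L; rewrite coefNf Ha // oppr0. Qed.
Lemma under1 : under 1. Proof. exact: underC. Qed.
Lemma underX a n : under a -> under (a ^+ n).
Proof. by move=> Ha; elim: n => [|n IH]; [exact: under1|rewrite exprS; apply: underM]. Qed.
Lemma under_comp a p q : under p -> under q -> under (fcomp a p q).
Proof.
move=> Hp Hq i j L; rewrite fcompE big1 // => m _; rewrite big1 // => n _.
by rewrite (underM (underX _ Hp) (underX _ Hq)) // mulr0.
Qed.
Lemma under_finv a : under a -> under (finv a).
Proof.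
move=> Ha; apply: underM; first exact: underC.
apply: under_comp; last by move=> i j _; rewrite coef0f.
by apply: underD; [apply: underM => //; exact: underC|apply: underN; exact: under1].
Qed.

(** Pull-back by [y = X * Y]. As a composition it is a ring morphism at once, while [blowE] gives
    access to supports. *)
Definition blow a : fps K := fcomp a (fX K) (fX K * fY K).

Lemma blowE a i j : blow a i j = if (j <= i)%N then a (i - j)%N j else 0.
Proof.
have X00 : fX K 0%N 0%N = 0 by rewrite coefXE.
have XY00 : (fX K * fY K) 0%N 0%N = 0 by rewrite coefXM.
pose g a : fps K := fun i j => if (j <= i)%N then a (i - j)%N j else 0.
rewrite -[RHS]/(g a i j); move: i j; suff -> : blow a = g a by [].
move: a; apply: (@fps_operator_eq _ 0).
- by move=> a b; rewrite /blow fcompD.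
- move=> a b; apply: fps_ext => i j; rewrite coefDf /g.
  by case: (j <= i)%N; rewrite ?coefDf ?addr0.
- by move=> d a b; rewrite addn0; apply: fcomp_eqd.
- by move=> d a b; rewrite addn0 => E i j L; rewrite /g; case: ifP => // L'; apply: E; lia.
- move=> c; rewrite /blow fcompC; apply: fps_ext => i j; rewrite /g !coefCf.
  case: i j => [|i] [|j] //; rewrite ?subn0 //=; case: ifP => //; by rewrite andbF.
- move=> a E; rewrite /blow fcompXM // -/(blow a) E; apply: fps_ext => i j.
  rewrite /g !coefXM; case: i => [|i]; first by case: j => [|j].
  have [L|L] := leqP j i; first by rewrite leqW // subSn.
  case: ifP => // L'; have -> : j = i.+1 by lia.
  by rewrite subnn.
- move=> a E; rewrite /blow fcompYM // -/(blow a) E; apply: fps_ext => i j.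
  by rewrite /g -mulrA coefXM coefYM; case: i j => [|i] [|j] //=; rewrite coefYM // ; case: ifP.
Qed.

End FormalWelding.

(** * Reduction to degree at most one in [x] *)

Section Welding.
Variables (K : numFieldType) (R : realType) (nr : K -> R).
Hypothesis afP : analytic_field nr.
Let nrP := af_abs afP.
Implicit Types (a b p q : fps K).

(** The coefficient of [x^m y^n] comes from degree [m + 2 * n], at most twice [m + n]; hence the
    growth rate [r ^- 2], valid once [r <= 1]. *)
Lemma analytic_blow_down (v : fps K) : analytic nr v ->
  analytic nr ((fun m n => v (m + n)%N n) : fps K).
Proof.
move=> [r' [C [r0' Bv']]]; pose r := Num.min 1 r'.
have r0 : 0 < r by rewrite lt_min ltr01.
have r1 : r <= 1 by rewrite ge_min lexx.
have Bv : bounded_at nr r C v.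
  by apply: (bounded_at_le nrP) Bv' => //; [exact: ltW|rewrite ge_min lexx orbT].
have C0 : 0 <= C by apply: le_trans (Bv 0%N); rewrite (fnorm_ge0 nrP) // ltW.
apply: (@analytic_coef K R nr nrP C (r ^- 2)); first by rewrite invr_gt0 exprn_gt0.
move=> m n; apply: (le_trans (bounded_coef nrP _ _ r0 Bv)).
apply: ler_wpM2l => //; rewrite exprVn lef_pV2 ?posrE ?exprn_gt0 // -exprM.
by apply: ler_wiXn2l; rewrite ?(ltW r0) //; lia.
Qed.

Proposition welding b : analytic nr b -> b 0%N 0%N = 0 -> b 1%N 0%N != 0 -> b 0%N 1%N != 0 ->
  exists B : fps K, [/\ analytic nr B, B 0%N 0%N = 0, B 0%N 1%N != 0,
    forall i j, (2 <= i)%N -> B i j = 0 &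
    conjugate_to (VField (fX K ^+ 2 : fps K) B) (VField (fX K ^+ 2 : fps K) b)].
Proof.
move=> Hb b00 b10 b01.
have X00 : fX K 0%N 0%N = 0 by rewrite coefXE.
have Y00 : fY K 0%N 0%N = 0 by rewrite coefYE.
have X0 a : (fX K * a) 0%N 0%N = 0 by rewrite coef00M X00 mul0r.
have Y0 a : (fY K * a) 0%N 0%N = 0 by rewrite coef00M Y00 mul0r.
have HX := analyticX nrP; have HY := analyticY nrP; have H1 := analytic1 nrP.
have Hbl a : analytic nr a -> analytic nr (blow a).
  by move=> Ha; apply: (analytic_comp nrP) => //; exact: (analyticM nrP).
have blM a a' : blow (a * a') = blow a * blow a' by rewrite /blow fcompM.
have blD a a' : blow (a + a') = blow a + blow a' by rewrite /blow fcompD.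
have bl1 : blow (1 : fps K) = 1 by rewrite /blow fcomp1.
have blX : blow (fX K) = fX K by rewrite /blow fcompX.
have blY : blow (fY K) = fX K * fY K by rewrite /blow fcompY.
have Eb : blow b = fX K * shX (blow b).
  apply: fps_ext => i j; rewrite coefXM /shX; case: i => // ; rewrite blowE.
  by case: j => [|j]; rewrite ?subn0.
(* The derivative of the slope [z = y / x] along the field, [b(x, x * z) / x - x * z]. *)
pose be := shX (blow b) - fX K * fY K.
have be0 : be 0%N 0%N != 0 by rewrite /be coefBf X0 subr0 /shX blowE subn0.
have Hbe : analytic nr be.
  by apply: (analyticB nrP); [apply: (analytic_shX nrP); exact: Hbl|exact: (analyticM nrP)].
pose ga := finv be.
have [chi [Hchi chi0 Ew]] := flow_box nrP (analytic_finv nrP be0 Hbe).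
have [v [tau [[Hv Htau v_over tau_under] [tau0 tau11 Ev]]]] := weld nrP Hchi.
have v0 : v 0%N 0%N = 0 by rewrite v_over.
(* As [v] contains only monomials with [i > j], it descends to a genuine series in [xi] and [y],
   divisible by [xi]. *)
pose vv : fps K := fun m n => v (m + n)%N n.
have Hvv : analytic nr vv := analytic_blow_down Hv.
have blvv : blow vv = v.
  apply: fps_ext => i j; rewrite blowE /vv; case: ifP => [L|/negbT]; first by rewrite subnK.
  by rewrite -ltnNge => L; rewrite v_over // ltnW.
pose g := fX K * (1 + vv).
have vv0 n : vv 0%N n = 0 by rewrite /vv add0n v_over.
have g0 : g 0%N 0%N = 0 := X0 _.
pose T := 1 + tau; pose t := fX K * T; pose Vi := finv1 v; pose z := fY K * Vi.
pose V := 1 + v; have VVi : V * Vi = 1 by rewrite /V /Vi finv1P.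
pose x := fX K * V; pose w := 1 + fX K * (fY K * chi).
have t0 : t 0%N 0%N = 0 := X0 _.
have z0 : z 0%N 0%N = 0 := Y0 _.
have x0 : x 0%N 0%N = 0 := X0 _.
have blg : blow g = x by rewrite /g blM blX blD bl1 blvv.
have xz : x * z = fX K * fY K.
  by rewrite /x /z mulrACA VVi mulr1.
have Ex : x = fcomp (fX K * w) t z.
  rewrite fcompXM // /w fcompD // fcomp1 fcompXM // fcompYM // /x /V Ev -/T -/t -/Vi -/z /t /z.
  by ring.
(* [th] and [na] act on pulled back series as [x d/dx], and as a derivation killing the
   first integral [t]. *)
pose th a := fX K * dX a - fY K * dY a.
have thD a a' : th (a + a') = th a + th a' by rewrite /th dXD dYD; ring.
have thM a a' : th (a * a') = th a * a' + a * th a' by rewrite /th dXM dYM; ring.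
have thC c : th (fcst c) = 0 by rewrite /th dXC dYC; ring.
have th_c d a a' : eqd d.+1 a a' -> eqd d (th a) (th a').
  by move=> E; apply: eqdB; apply: eqdM => //; [exact: dX_eqd|exact: dY_eqd].
pose na a := dY t * th a - th t * dY a.
have naD a a' : na (a + a') = na a + na a' by rewrite /na thD dYD; ring.
have naM a a' : na (a * a') = na a * a' + a * na a' by rewrite /na thM dYM; ring.
have naC c : na (fcst c) = 0 by rewrite /na thC dYC; ring.
have na_c d a a' : eqd d.+1 a a' -> eqd d (na a) (na a').
  by move=> E; apply: eqdB; apply: eqdM => //; [exact: th_c|exact: dY_eqd].
have na_t : na t = 0 by rewrite /na; ring.
have chain p q a : p 0%N 0%N = 0 -> q 0%N 0%N = 0 ->
    na (fcomp a p q) = fcomp (dX a) p q * na p + fcomp (dY a) p q * na q.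
  by move=> p0 q0; apply: fcomp_chain.
(* Along [na] the parameter [t] is constant, so [x] varies with [z] alone, by the flow equation. *)
have E1 : na x = x ^+ 2 * (fcomp ga x z * na z).
  rewrite {1}Ex chain // na_t mulr0 add0r dYX Ew.
  rewrite !fcompXM // fcompM // fcompXn // fcompA //.
  have -> : fcomp (fX K * w) t z = x by rewrite -Ex.
  by rewrite fcompY // Ex fcompXM //; ring.
have E2 : fcomp be x z * fcomp ga x z = 1 by rewrite -fcompM // finvP // fcomp1.
have E3 : x * fcomp be x z = blow (fcomp b g (fY K)) - x * (fX K * fY K).
  have -> : x * fcomp be x z = fcomp (fX K * be) x z by rewrite fcompXM.
  rewrite /be mulrBr -Eb fcompB // !fcompXM // fcompY // xz; congr (_ - _).
  rewrite /blow !fcompA // fcompXM // !fcompX // !fcompY // xz.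
  by rewrite -/(blow g) blg.
set bg := fcomp b g (fY K) in E3.
have E4 : (blow bg - x * (fX K * fY K)) * na x = x ^+ 2 * (x * na z).
  rewrite -E3 E1; transitivity (x ^+ 3 * na z * (fcomp be x z * fcomp ga x z)); first by ring.
  by rewrite E2; ring.
have E5 : na (fX K * fY K) = x * na z + na x * z by rewrite -xz naM; ring.
(* The equation [b dx = x^2 dy] of the leaves, with [y = X * Y]. *)
have E6 : blow bg * na x = x ^+ 2 * na (fX K * fY K).
  rewrite E5; transitivity ((blow bg - x * (fX K * fY K)) * na x + x * (x * z) * na x).
    by rewrite xz; ring.
  by rewrite E4; ring.
have naX : na (fX K) = fX K * dY t.
  by rewrite /na /th dX_X dY_X; ring.
have naXY : na (fX K * fY K) = - (fX K * th t).
  by rewrite naM naX /na /th dX_Y dY_Y; ring.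
have na_bl a : na (blow a) = fX K * (dY t * blow (dX a) - th t * blow (dY a)).
  rewrite /blow chain // naX naXY; ring.
(* [tau] is divisible by [X], hence [dY t] by [X^2]. The quotient [- rho] has constant term
   [- chi(0, 0) = - 1 / b_x(0, 0)], so [rho] can be divided by. *)
pose rho := - dY (shX tau); pose D := T + th T.
have dYt : dY t = - (fX K * (fX K * rho)).
  rewrite /t dYX /T dYD -fcst1 dYC add0r.
  have -> : tau = fX K * shX tau.
    by apply: fps_ext => i j; rewrite coefXM /shX; case: i.
  by rewrite dYX /rho; ring.
have tht : th t = fX K * D by rewrite /t thM /D /th dX_X dY_X; ring.
pose h := dY (shX vv).
have Evv : vv = fX K * shX vv.
  by apply: fps_ext => i j; rewrite coefXM /shX; case: i => //; rewrite vv0.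
have gy : dY g = fX K ^+ 2 * h.
  by rewrite /g dYX dYD -fcst1 dYC add0r {1}Evv dYX /h; ring.
(* If [(g, y)] sends [xi^2 d/dxi + B d/dy] to [u] times the given field, then [B = u * bg] and
   [dX g + B * h = u * (1 + vv)^2], that is [u * A = dX g]. This determines [u]. *)
pose A := (1 + vv) ^+ 2 - bg * h.
have E7 : rho * (blow bg * blow (dX g)) = fX K * D * blow A.
  have : fX K * (fX K * (fX K * (rho * (blow bg * blow (dX g))))) =
         fX K * (fX K * (fX K * (fX K * D * blow A))).
    have blA : blow A = V ^+ 2 - blow bg * blow h.
      have -> : A = (1 + vv) * (1 + vv) + (- 1) * (bg * h) by rewrite /A; ring.
      rewrite blD !blM blD bl1 blvv -/V.
      have -> : blow (- 1 : fps K) = - 1 by rewrite /blow fcompN fcomp1.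
      by ring.
    have blX2 : blow (fX K ^+ 2) = fX K ^+ 2 by rewrite expr2 blM blX.
    move: E6; rewrite naXY -{1}blg na_bl gy tht dYt blM blX2.
    rewrite blA /x => E6.
    apply/eqP; rewrite -subr_eq0; apply/eqP.
    move/eqP: E6; rewrite -subr_eq0 => /eqP E6.
    transitivity (- (0 : fps K)); last by rewrite oppr0.
    by rewrite -E6; ring.
  by do 3 move/fX_inj.
have bg0 : bg 0%N 0%N = 0 by rewrite /bg coef00_comp.
have A0 : A 0%N 0%N = 1.
  by rewrite /A coefBf coef00X coefDf coef1f vv0 coef00M bg0 mul0r subr0 addr0 expr1n.
have A0' : A 0%N 0%N != 0 by rewrite A0 oner_neq0.
have gx0 : dX g 0%N 0%N = 1.
  by rewrite /g dXX coefDf X0 coefDf coef1f vv0 !addr0.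
pose u := dX g * finv A; pose B := u * bg.
have u0 : u 0%N 0%N = 1 by rewrite /u coef00M gx0 coef00_finv // A0 invr1 mul1r.
have uA : u * A = dX g by rewrite /u -mulrA [finv A * A]mulrC finvP // mulr1.
have E8 : rho * blow B = fX K * D.
  have EA : blow A * blow (finv A) = 1 by rewrite -blM finvP.
  rewrite /B blM /u (blM (dX g)); transitivity (rho * (blow bg * blow (dX g)) * blow (finv A)).
    by move: (blow (dX g)) (blow (finv A)) (blow bg) => a1 a2 a3; ring.
  by rewrite E7 -[RHS]mulr1 -EA mulrA.
have rho0 : rho 0%N 0%N != 0.
  by rewrite /rho coefNf /dY /sderivY /shX mulr1n tau11 opprK chi0 finv_neq0.
have E9 : blow B = fX K * (D * finv rho).
  by rewrite mulrA -E8 mulrAC finvP // mul1r.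
(* The supports show that [B] has degree at most one in [x]. *)
have D_under : under (D * finv rho).
  apply: underM.
    apply: underD; first by apply: underD => //; exact: under1.
    have T_under : under T by apply: underD => //; exact: under1.
    move=> i j L; rewrite /th coefBf coefXM coefYM /dX /dY /sderivX /sderivY.
    case: i L => // i L; case: j L => [|j] L /=; first by rewrite T_under // mul0rn subr0.
    by rewrite !T_under // !mul0rn subr0.
  apply: under_finv => i j L; rewrite /rho coefNf /dY /sderivY /shX.
  by rewrite tau_under ?mul0rn ?oppr0.
have Hg : analytic nr g by apply: (analyticM nrP) => //; exact: (analyticD nrP).
have Hbg : analytic nr bg by exact: (analytic_comp nrP).
have HA : analytic nr A.
  apply: (analyticB nrP); first by apply: (analyticXn nrP); exact: (analyticD nrP).
  by apply: (analyticM nrP) => //; apply: (analytic_dY nrP); exact: (analytic_shX nrP).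
have Hu : analytic nr u.
  by apply: (analyticM nrP); [exact: (analytic_dX nrP)|exact: (analytic_finv nrP)].
exists B; split.
- exact: (analyticM nrP).
- by rewrite /B coef00M bg0 mulr0.
- rewrite /B coef01M u0 bg0 mulr0 add0r mul1r /bg coef01_comp //.
  by rewrite /g coefXM coefYE /= mulr0 add0r mulr1.
- move=> i j L; have := blowE B (i + j) j; rewrite leq_addl addnK => <-.
  by rewrite E9 coefXM; case: i L => // i L; rewrite addSn D_under //; lia.
apply/(conjugateP afP); exists g, (fY K), u; split; split=> //.
- rewrite /jac /g !coefXM !coefYE /= mulr1 mulr0 subr0 coefDf coef1f vv0 addr0 /=; exact: oner_neq0.
- by rewrite u0 oner_neq0.
- rewrite /flie /= expr2 fcompM // fcompX // gy -uA /B -/bg.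
  rewrite (_ : g * g = fX K ^+ 2 * ((1 + vv) ^+ 2)); last by rewrite /g; ring.
  rewrite /A; ring.
- by rewrite flie_Y.
Qed.

End Welding.

(** * The prepared form *)

Section Preparation.
Variables (K : numFieldType) (R : realType) (nr : K -> R).
Hypothesis afP : analytic_field nr.
Let nrP := af_abs afP.
Implicit Types (a b p q : fps K).

(** Series in [y] alone stay inside [fps] and are recognized by [rowY a = a]; no second ring is
    built. *)
Definition rowY a : fps K := fun i j => if i == 0%N then a i j else 0.

Lemma rowYE a : rowY a = fcomp a 0 (fY K).
Proof.
have Y00 : fY K 0%N 0%N = 0 by rewrite coefYE.
move: a; apply: (@fps_operator_eq _ 0).
- move=> a b; apply: fps_ext => i j; rewrite coefDf /rowY coefDf.
  by case: ifP; rewrite ?addr0.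
- by move=> a b; rewrite fcompD.
- by move=> d a b; rewrite addn0 => E i j L; rewrite /rowY; case: ifP => // _; apply: E.
- by move=> d a b; rewrite addn0; apply: fcomp_eqd.
- move=> c; rewrite fcompC; apply: fps_ext => i j; rewrite /rowY !coefCf.
  by case: i.
- move=> a E; rewrite fcompXM // -E mul0r; apply: fps_ext => i j.
  by rewrite /rowY coefXM; case: i.
- move=> a E; rewrite fcompYM // -E; apply: fps_ext => i j.
  by rewrite /rowY !coefYM; case: i j => [|i] [|j].
Qed.

Lemma rowYD a b : rowY (a + b) = rowY a + rowY b. Proof. by rewrite !rowYE fcompD. Qed.
Lemma rowYM a b : rowY (a * b) = rowY a * rowY b.
Proof. by rewrite !rowYE fcompM // coefYE. Qed.
Lemma rowYK a : rowY (rowY a) = rowY a.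
Proof. by apply: fps_ext => i j; rewrite /rowY; case: (i == 0%N). Qed.
Lemma rowY_Y : rowY (fY K) = fY K.
Proof. by rewrite rowYE fcompY // coefYE. Qed.
Lemma rowYC c : rowY (fcst c) = fcst c.
Proof. by rewrite rowYE fcompC. Qed.
Lemma rowY_dom a i j : nr (rowY a i j) <= nr (a i j).
Proof. by rewrite /rowY; case: ifP => // _; rewrite (nr0 nrP) (nr_ge0 nrP). Qed.
Lemma rowY_dY a : rowY (dY a) = dY (rowY a).
Proof.
by apply: fps_ext => i j; rewrite /rowY /dY /sderivY; case: ifP => // _; rewrite mul0rn.
Qed.

Lemma rowY_comp a p q : p 0%N 0%N = 0 -> q 0%N 0%N = 0 -> rowY a = a ->
  fcomp a p q = fcomp a 0 q.
Proof.
by move=> p0 q0 E; rewrite -E rowYE !fcompA ?coefYE // !fcomp0 // !fcompY.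
Qed.

Lemma rowY_shY a : a 0%N 0%N = 0 -> rowY a = a -> a = fY K * shY a.
Proof.
move=> a0 E; apply: fps_ext => i j; rewrite coefYM /shY; case: j => // .
by rewrite -E /rowY; case: i.
Qed.

(** Picard iteration, contracting because integration brings a factor [y]. Applying [rowY] inside
    the map keeps the solution free of [x]. *)
Lemma linear_ode ka : analytic nr ka -> rowY ka = ka ->
  exists m, [/\ analytic nr m, rowY m = m, m 0%N 0%N = 1 & dY m = ka * m].
Proof.
move=> Hka kaY; have Y00 : fY K 0%N 0%N = 0 by rewrite coefYE.
have Y0 a : (fY K * a) 0%N 0%N = 0 by rewrite coef00M Y00 mul0r.
pose F (U : unit -> fps K) (i : unit) := fY K * primY (rowY (ka * (1 + U i))).
have Fc (U V : unit -> fps K) d : centered U -> centered V ->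
    (forall i, eqd d (U i) (V i)) -> forall i, eqd d.+1 (F U i) (F V i).
  move=> Uc Vc E i; rewrite /F; apply: eqd1M => //; apply: primY_eqd.
  have E' : eqd d (ka * (1 + U i)) (ka * (1 + V i)) by apply: eqdM => //; apply: eqdD.
  by move=> k l L; rewrite /rowY E'.
have [u [uc Fu Hu]] := @fixed_point K unit F (fun U _ i => Y0 _) (fun d U V => @Fc U V d).
pose mu := u tt; have Emu : mu = fY K * primY (rowY (ka * (1 + mu))) by rewrite /mu -{1}Fu.
have mu0 : mu 0%N 0%N = 0 by rewrite Emu Y0.
have muY : rowY mu = mu.
  rewrite {2}Emu; apply: fps_ext => i j; rewrite /rowY {1}Emu !coefYM.
  by case: i j => [|i] [|j] //=; rewrite /primY /rowY /= mul0r.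
have an : analytic nr mu.
  have [s [C [s0 C1 Bs _]]] := analytic2 nrP Hka Hka.
  have C0 : 0 < C by rewrite (lt_le_trans _ C1).
  pose r := Num.min s (1 / (2 * C)).
  have r0 : 0 < r by rewrite !lt_min s0 divr_gt0 // mulr_gt0.
  have r0' := ltW r0.
  have rC : r * (2 * C) <= 1.
    by rewrite -ler_pdivlMr ?mulr_gt0 // /r !ge_min lexx !orbT.
  have Br : bounded_at nr r C ka.
    by apply: (bounded_at_le nrP) Bs => //; rewrite /r ge_min lexx.
  exists r, 1; split=> //; apply: Hu => // d w wc Lw i; rewrite /F.
  apply: le_trans rC; apply: (fnormMle nrP) => //; first exact: (fnorm_Y nrP).
  apply: le_trans (fnorm_primY nrP _ _ r0') _.
  apply: (@le_trans _ _ (fnorm nr d r (ka * (1 + w i)))).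
    by apply: (fnorm_dom nrP) => // k l _; exact: rowY_dom.
  rewrite mulrC; apply: (fnormMle nrP) => //.
  apply: (le_trans (fnormD nrP _ _ _ r0')); rewrite (_ : 2 = 1 + 1 :> R); last by ring.
  by apply: lerD => //; exact: (fnorm1 nrP).
exists (1 + mu); split.
- by apply: (analyticD nrP) => //; exact: (analytic1 nrP).
- by rewrite rowYD muY -fcst1 rowYC.
- by rewrite coefDf coef1f mu0 addr0.
- rewrite dYD -fcst1 dYC add0r {1}Emu dY_primY rowYM kaY rowYD muY rowYC //.
Qed.

(** A one-variable field [S0(y) d/dy] with [S0'(0) = la] nonzero is linearized by a solution of
    [S0 * l' = la * l]. The part [x * S1(y)] keeps its shape under a change of [y] alone and becomes
    [x * f(y)]. *)
Lemma linearize (B : fps K) : analytic nr B -> B 0%N 0%N = 0 -> B 0%N 1%N != 0 ->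
  (forall i j, (2 <= i)%N -> B i j = 0) ->
  exists f, convergent1 f /\ conjugate_to (VField (fX K ^+ 2 : fps K) B) (prepared_form f).
Proof.
move=> HB B00 B01 B2; set la := B 0%N 1%N in B01.
have X00 : fX K 0%N 0%N = 0 by rewrite coefXE.
have Y00 : fY K 0%N 0%N = 0 by rewrite coefYE.
have Y0 a : (fY K * a) 0%N 0%N = 0 by rewrite coef00M Y00 mul0r.
have HX := analyticX nrP; have HY := analyticY nrP; have H1 := analytic1 nrP.
pose S0 := rowY B; pose S1 := rowY (shX B).
have EB : B = S0 + fX K * S1.
  apply: fps_ext => i j; rewrite coefDf coefXM /S0 /S1 /rowY /shX.
  by case: i => [|[|i]] /=; rewrite ?addr0 ?add0r // B2.
have HS0 : analytic nr S0 by apply: (analytic_dom nrP) HB => i j; exact: rowY_dom.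
have HS1 : analytic nr S1.
  by apply: (analytic_dom nrP) (analytic_shX nrP HB) => i j; exact: rowY_dom.
have S0Y : rowY S0 = S0 by exact: rowYK.
have S1Y : rowY S1 = S1 by exact: rowYK.
have ES0 : S0 = fY K * shY S0 by apply: rowY_shY => //; rewrite /S0 /rowY.
have shY_row a : rowY a = a -> rowY (shY a) = shY a.
  by move=> E; apply: fps_ext => i j; rewrite /shY -E /rowY; case: i.
pose e := fcst la^-1 * shY S0.
have eY : rowY e = e by rewrite /e rowYM rowYC shY_row.
have e0 : e 0%N 0%N = 1 by rewrite /e coefCM /shY /S0 /rowY /= mulVf.
have e0' : e 0%N 0%N != 0 by rewrite e0 oner_neq0.
have ES0' : S0 = fcst la * (fY K * e).
  rewrite {1}ES0 /e; transitivity (fcst la * fcst la^-1 * (fY K * shY S0)); last by ring.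
  by rewrite -fcstM mulfV // fcst1 mul1r.
have He : analytic nr e.
  by apply: (analyticM nrP); [exact: (analyticC nrP)|exact: (analytic_shY nrP)].
have ieY : rowY (finv e) = finv e.
  have E : e * rowY (finv e) = 1 by rewrite -{1}eY -rowYM finvP // -fcst1 rowYC.
  rewrite -[RHS]mul1r -E mulrAC finvP // mul1r //.
(* Writing [l = y * m] and [S0 = la * y * e] turns the singular equation for [l] into [m' = ka * m]
   with the regular coefficient [ka = (1 / e - 1) / y]. *)
pose ka := shY (finv e - 1).
have E0 : (finv e - 1) 0%N 0%N = 0 by rewrite coefBf coef1f coef00_finv // e0 invr1 subrr.
have EY : rowY (finv e - 1) = finv e - 1.
  by rewrite rowYD ieY -fcst1 -fcstN rowYC.
have Eka : finv e - 1 = fY K * ka by exact: rowY_shY.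
have Hka : analytic nr ka.
  by apply: (analytic_shY nrP); apply: (analyticB nrP) => //; exact: (analytic_finv nrP).
have [m [Hm mY m0 dm]] := linear_ode Hka (shY_row _ EY).
pose l := fY K * m.
have l0 : l 0%N 0%N = 0 := Y0 _.
have lY : rowY l = l by rewrite /l rowYM rowY_Y mY.
have Hl : analytic nr l by exact: (analyticM nrP).
have dl : dY l = m * finv e.
  rewrite /l dYY dm (_ : fY K * (ka * m) = (fY K * ka) * m); last by ring.
  by rewrite -Eka; ring.
have S0l : S0 * dY l = fcst la * l.
  rewrite ES0' dl (_ : _ * _ = fcst la * (fY K * m) * (e * finv e)); last by ring.
  by rewrite finvP // mulr1.
have dXl : dX l = 0.
  apply: fps_ext => i j; rewrite /dX /sderivX -lY /rowY /=; exact: mul0rn.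
have l01 : l 0%N 1%N = 1 by rewrite /l coefYM.
have l10 : l 1%N 0%N = 0 by rewrite /l coefYM.
have J : jac (fX K) l != 0.
  by rewrite /jac !coefXE l01 l10 /= mulr0 subr0 mulr1 oner_neq0.
have [s [t [[Hs Ht s0 t0] [_ C1 C2 C3 C4]]]] := inverse_function nrP HX Hl X00 l0 J.
pose h := S1 * dY l; have hY : rowY h = h by rewrite /h rowYM S1Y rowY_dY lY.
pose f := rowY (fcomp h (fX K) t).
have fE p : p 0%N 0%N = 0 -> fcomp f p l = h.
  move=> p0; rewrite (rowY_comp p0 l0) ?rowYK // /f rowYE !fcompA ?coef0f ?coef00_comp //.
  rewrite !fcomp0 // fcompX // fcompY //.
  have -> : fcomp t 0 l = fY K.
    move/(congr1 rowY): C4; rewrite rowY_Y => <-.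
    by rewrite rowYE fcompA // fcompX // -rowYE lY.
  by rewrite -rowYE hY.
have Ef : sliftY (fun j => f 0%N j) = f.
  by apply: fps_ext => i j; rewrite /sliftY /f /rowY; case: i.
exists (fun j => f 0%N j); split.
  apply/(af_conv1 afP); rewrite Ef; apply: (analytic_dom nrP (rowY_dom _)).
  apply: (analytic_comp nrP) => //; apply: (analyticM nrP) => //; exact: (analytic_dY nrP).
have aX0 : (fcst la^-1 * fX K) 0%N 0%N = 0 by rewrite coefCM X00 mulr0.
(* The multiplier [la] makes the eigenvalue 1, and rescaling [x] by [1 / la] restores the
   coefficient of [x^2 d/dx]. *)
apply/(conjugateP afP); exists (fcst la^-1 * fX K), l, (fcst la); split; split=> //.
- by apply: (analyticM nrP) => //; exact: (analyticC nrP).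
- by rewrite /jac !coefCM !coefXE l01 l10 /= !mulr0 subr0 !mulr1 invr_eq0.
- exact: (analyticC nrP).
- have -> : vfX (prepared_form (fun j => f 0%N j)) = fX K ^+ 2 :> fps K.
    by rewrite /= (smonoE 1 2 0) fcst1 mul1r expr0 mulr1.
  rewrite fcompXn // fcompX // /flie dXCM dYCM dX_X dY_X /=.
  transitivity (fcst la^-1 * fX K ^+ 2 * (fcst la * fcst la^-1)); last by ring.
  by rewrite -fcstM mulfV // fcst1; ring.
- have -> : vfY (prepared_form (fun j => f 0%N j)) = fY K + fX K * f.
    by rewrite /= Ef.
  rewrite fcompD fcompY // fcompXM // fE // /flie /= dXl mulr0 add0r {1}EB mulrDl S0l.
  rewrite mulrDr; congr (_ + _).
  transitivity (fX K * h * (fcst la * fcst la^-1)); last by ring.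
  by rewrite -fcstM mulfV // fcst1 /h; ring.
Qed.

Proposition preparation b : analytic nr b -> b 0%N 0%N = 0 -> b 0%N 1%N != 0 ->
  exists f, convergent1 f /\ conjugate_to (VField (fX K ^+ 2 : fps K) b) (prepared_form f).
Proof.
have X00 : fX K 0%N 0%N = 0 by rewrite coefXE.
have Y00 : fY K 0%N 0%N = 0 by rewrite coefYE.
have HX := analyticX nrP; have HY := analyticY nrP.
have main a : analytic nr a -> a 0%N 0%N = 0 -> a 1%N 0%N != 0 -> a 0%N 1%N != 0 ->
    exists f, convergent1 f /\ conjugate_to (VField (fX K ^+ 2 : fps K) a) (prepared_form f).
  move=> Ha a0 a10 a01; have [B [HB B0 B01 B2 cB]] := welding afP Ha a0 a10 a01.
  have [f [Hf cf]] := linearize HB B0 B01 B2.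
  by exists f; split=> //; apply: (conjugate_trans afP) cf; apply: (conjugate_sym afP).
move=> Hb b00 b01; have [b10|b10] := eqVneq (b 1%N 0%N) 0; last exact: main.
(* For the coordinate [y + x] the term [x^2] is the derivative of [x] along the field, and
   [b'_x(0, 0) = - b_y(0, 0)] is nonzero. *)
pose q := fY K - fX K; pose b' := fcomp (b + fX K ^+ 2) (fX K) q.
have q0 : q 0%N 0%N = 0 by rewrite /q coefBf X00 Y00 subrr.
have Hq : analytic nr q by exact: (analyticB nrP).
have Hb' : analytic nr b'.
  by apply: (analytic_comp nrP) => //; apply: (analyticD nrP) => //; exact: (analyticXn nrP).
have X2_10 : (fX K ^+ 2) 1%N 0%N = 0 by rewrite expr2 coefXM coefXE.
have X2_01 : (fX K ^+ 2) 0%N 1%N = 0 by rewrite expr2 coefXM.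
have [||| f [Hf cf]] := main b' Hb'.
- by rewrite /b' coef00_comp coefDf b00 coef00X X00 expr0n addr0.
- rewrite /b' coef10_comp // /q coefBf !coefDf !coefXE coefYE b10 X2_10 X2_01 /=.
  by rewrite !addr0 mul0r add0r sub0r mulrN1 oppr_eq0.
- rewrite /b' coef01_comp // /q coefBf !coefDf !coefXE coefYE X2_01 /=.
  by rewrite mulr0 add0r subr0 mulr1 addr0.
exists f; split=> //; apply: (conjugate_trans afP) cf.
have r0 : (fY K + fX K) 0%N 0%N = 0 by rewrite coefDf X00 Y00 addr0.
apply/(conjugateP afP); exists (fX K), (fY K + fX K), 1; split; split=> //.
- exact: (analyticD nrP).
- by rewrite /jac !coefDf !coefXE !coefYE /= addr0 mul0r subr0 mulr1 oner_neq0.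
- exact: (analytic1 nrP).
- by rewrite coef1f oner_neq0.
- by rewrite flie_X /= fcompXn // fcompX // mul1r.
- rewrite /= /b' fcompA // fcompX // fcompB fcompY // fcompX // addrK fcomp_id mul1r.
  by rewrite /flie /= dXD dYD dX_X dX_Y dY_X dY_Y; ring.
Qed.

End Preparation.

(** * Invariance of the residue *)

Section Invariants.
Variable K : numFieldType.
Implicit Types (a b p q : fps K).

Lemma coef11M a b : (a * b) 1%N 1%N = a 0%N 0%N * b 1%N 1%N + a 0%N 1%N * b 1%N 0%N +
  a 1%N 0%N * b 0%N 1%N + a 1%N 1%N * b 0%N 0%N.
Proof. by rewrite coefMf !big_ord_recl !big_ord0 /=; ring. Qed.
Lemma coef20M a b : (a * b) 2%N 0%N = a 0%N 0%N * b 2%N 0%N + a 1%N 0%N * b 1%N 0%N +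
  a 2%N 0%N * b 0%N 0%N.
Proof. by rewrite coefMf !big_ord_recl !big_ord0 /=; ring. Qed.
Lemma coef30M a b : (a * b) 3%N 0%N = a 0%N 0%N * b 3%N 0%N + a 1%N 0%N * b 2%N 0%N +
  a 2%N 0%N * b 1%N 0%N + a 3%N 0%N * b 0%N 0%N.
Proof. by rewrite coefMf !big_ord_recl !big_ord0 /=; ring. Qed.

(** [d] and [c] are the [d/dy] components of source and target, [(P, Q)] is the conjugacy and [U]
    its multiplier. Comparing well-chosen coefficients of [EP] and [EQ] determines the needed jets
    one after the other. *)
Variables (mu : K) (d : fps K).
Hypotheses (d00 : d 0%N 0%N = 0) (d10 : d 1%N 0%N = 0) (d01 : d 0%N 1%N = 1)
  (d11 : d 1%N 1%N = mu).
Variables (P Q U c : fps K).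
Hypotheses (P0 : P 0%N 0%N = 0) (Q0 : Q 0%N 0%N = 0) (c0 : c 0%N 0%N = 0)
  (J : jac P Q != 0).
Hypothesis EP : fX K ^+ 2 * dX P + d * dY P = U * P ^+ 2.
Hypothesis EQ : fX K ^+ 2 * dX Q + d * dY Q = U * fcomp c P Q.

Lemma invariant_P01 : P 0%N 1%N = 0.
Proof.
move/(congr1 (fun a : fps K => a 0%N 1%N)): EP.
rewrite coefDf coefXnM /= coef01M expr2 coef01M coef01M coef00M P0 d00 d01.
by rewrite {1}/dY /sderivY mulr1n !(mul0r, mulr0, add0r, addr0, mul1r).
Qed.

Lemma invariant_PQ : (P 1%N 0%N != 0) && (Q 0%N 1%N != 0).
Proof.
by move: J; rewrite /jac invariant_P01 mul0r subr0 mulf_eq0 negb_or.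
Qed.

Lemma invariant_eigenvalue : U 0%N 0%N * c 0%N 1%N = 1.
Proof.
have /andP[_ Q01] := invariant_PQ.
move/(congr1 (fun a : fps K => a 0%N 1%N)): EQ.
rewrite coefDf coefXnM /= coef01M [RHS]coef01M coef00_comp c0 d00 d01 coef01_comp //.
rewrite invariant_P01 {1}/dY /sderivY mulr1n !(mul0r, mulr0, add0r, addr0, mul1r) mulrA => E.
by apply: (mulIf Q01); rewrite mul1r -E.
Qed.

Lemma invariant_P10 : U 0%N 0%N * P 1%N 0%N = 1.
Proof.
have /andP[P10 _] := invariant_PQ.
move/(congr1 (fun a : fps K => a 2%N 0%N)): EP.
rewrite coefDf coefXnM /= coef20M d00 d10 [RHS]coef20M expr2 coef20M coef10M coef00M P0.
rewrite /dX /dY /sderivX /sderivY !mulr1n invariant_P01 => E; apply: (mulIf P10).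
by move: E; rewrite !(mul0r, mulr0, add0r, addr0) => E; rewrite -mulrA mul1r -E.
Qed.

Lemma invariant_P11 : P 1%N 1%N = 0.
Proof.
move/(congr1 (fun a : fps K => a 1%N 1%N)): EP.
rewrite coefDf coefXnM /= coef11M d00 d10 d01 d11 [RHS]coef11M expr2.
rewrite coef11M coef10M coef01M coef00M.
rewrite P0 /dX /dY /sderivX /sderivY !mulr1n invariant_P01.
by rewrite !(mul0r, mulr0, add0r, addr0) mul1r.
Qed.

(** In the coefficient of [x^3] of [EP] both sides contain twice the coefficient of [x^2] in [P];
    the rest is the claim. *)
Lemma invariant_U10 : c 0%N 1%N = 1 -> U 1%N 0%N = 0.
Proof.
move=> c01; have U0 : U 0%N 0%N = 1 by rewrite -invariant_eigenvalue c01 mulr1.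
have P10 : P 1%N 0%N = 1 by rewrite -invariant_P10 U0 mul1r.
have P11 := invariant_P11.
move/(congr1 (fun a : fps K => a 3%N 0%N)): EP.
rewrite coefDf coefXnM /= coef30M d00 d10 [RHS]coef30M expr2 coef30M coef20M coef10M coef00M.
rewrite P0 U0 P10 /dX /dY /sderivX /sderivY !mulr1n invariant_P01 P11 subSnn.
rewrite !(mul0r, mulr0, add0r, addr0, mul1r, mulr1) mulr2n.
by move=> E; apply/esym/(addrI (P 2%N 0%N + P 2%N 0%N)); rewrite -E addr0.
Qed.

(** In the coefficient of [x * y] of [EQ], the vanishing of [U 1 0] and [comp10] removes the cross
    terms. Up to the common term [Q 1 1], what remains is [mu] and [f 0 1], each times the nonzero
    [Q 0 1]. *)
Lemma invariant_mu (f : fps K) : rowY f = f -> c = fY K + fX K * f -> f 0%N 1%N = mu.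
Proof.
move=> rowf Ec; have /andP[_ Q01] := invariant_PQ.
have c01 : c 0%N 1%N = 1 by rewrite Ec coefDf coefYE coefXM addr0.
have U0 : U 0%N 0%N = 1 by rewrite -invariant_eigenvalue c01 mulr1.
have P10 : P 1%N 0%N = 1 by rewrite -invariant_P10 U0 mul1r.
have U10 := invariant_U10 c01.
have comp10 : fcomp c P Q 1%N 0%N = 0.
  move/(congr1 (fun a : fps K => a 1%N 0%N)): EQ.
  rewrite coefDf coefXnM /= coef10M [RHS]coef10M coef00_comp c0 d00 d10 U0.
  by rewrite !(mul0r, mulr0, add0r, addr0) mul1r => <-.
have P11 := invariant_P11.
have comp11 : fcomp c P Q 1%N 1%N = Q 1%N 1%N + f 0%N 1%N * Q 0%N 1%N.
  rewrite Ec fcompD fcompY // fcompXM // coefDf coef11M P0 P10 P11 invariant_P01.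
  rewrite coef01_comp // coef00_comp invariant_P01.
  by rewrite !(mul0r, mulr0, add0r, addr0) mul1r.
move/(congr1 (fun a : fps K => a 1%N 1%N)): EQ.
rewrite coefDf coefXnM /= coef11M [RHS]coef11M d00 d10 d01 d11.
rewrite comp10 comp11 coef00_comp c0 U0 U10.
rewrite /dX /dY /sderivX /sderivY !mulr1n !(mul0r, mulr0, add0r, addr0) !mul1r.
by move/addrI => E; apply: (mulIf Q01).
Qed.

End Invariants.

(** * Real and complex coefficients *)

Section ConcreteFields.
Variable R : realType.
Local Open Scope complex_scope.

(** The topology on [R[i]] is only available through its [numFieldType] structure. *)
Let C : numFieldType := R[i].

Definition cnorm (z : R[i]) : R := Num.sqrt (complex.Re z ^+ 2 + complex.Im z ^+ 2).

Lemma cnormE (z : R[i]) : `|z| = (cnorm z)%:C.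
Proof. exact: normc_def. Qed.

Lemma absolute_value_normr : absolute_value (fun x : R => `|x|).
Proof.
split=> [x|x y|x y|x|n]; [exact: normr_ge0|exact: ler_normD|exact: normrM|exact: normrN|].
by rewrite ger0_norm.
Qed.

Lemma absolute_value_cnorm : absolute_value cnorm.
Proof.
split=> [x|x y|x y|x|n].
- exact: sqrtr_ge0.
- by rewrite -lecR rmorphD /= -!cnormE ler_normD.
- by apply: complexI; rewrite rmorphM /= -!cnormE normrM.
- by apply: complexI; rewrite /= -!cnormE normrN.
- by apply: complexI; rewrite /= -cnormE ger0_norm // rmorph_nat.
Qed.

Lemma cvgn_series_bounded (u : nat -> R) (M : R) : (forall n, 0 <= u n) ->
  (forall n, series u n <= M) -> cvgn (series u).
Proof.
move=> u0 uM; apply: nondecreasing_is_cvgn.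
  by apply: nondecreasing_series => n _ _; exact: u0.
by exists M => _ [n _ <-]; exact: uM.
Qed.

Lemma cvgn_series_complex (u : nat -> R) : cvgn (series u) ->
  cvgn (series (fun n => (u n)%:C : C)).
Proof.
move=> cu; have E n : series (fun n => (u n)%:C : C) n = (series u n)%:C.
  by rewrite /series /= rmorph_sum.
apply/cvg_ex; exists ((limn (series u))%:C : C); apply/cvgrPdist_lt => e e0.
have Ee : e = (complex.Re e)%:C by rewrite RRe_real // gtr0_real.
have e0' : 0 < complex.Re e by rewrite -ltcR -Ee.
move/cvgrPdist_lt: cu => /(_ _ e0'); apply: filterS => n.
rewrite E -rmorphB cnormE Ee ltcR => L.
by apply: le_lt_trans L; rewrite /cnorm /= expr0n addr0 sqrtr_sqr.
Qed.

Lemma cvgn_bound (K : numFieldType) (u : nat -> K) : cvgn u ->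
  exists M : K, forall n, `|u n| <= M.
Proof.
move=> /cvg_seq_bounded [M [Mr H]]; exists (M + 1) => n.
by apply: H; rewrite ?ltrDl // ltr01.
Qed.

Lemma analytic_field_real : analytic_field (fun x : R => `|x|).
Proof.
split; first exact: absolute_value_normr.
  have E (a : series2 R) (r : R) n :
      series (fun n => \sum_(i < n.+1) `|a i (n - i)%N : R| * r ^+ n) n =
      fnorm (fun x : R => `|x|) n r a by rewrite /series /= big_mkord.
  move=> a; split.
    move=> [r r0 /cvgn_bound [M HM]]; exists r, M; split=> // d.
    by apply: le_trans (HM d); rewrite E ler_norm.
  move=> [r [M [r0 Ba]]]; exists r => //; apply: (@cvgn_series_bounded _ M).
    by move=> n; apply: sumr_ge0 => i _; rewrite mulr_ge0 ?exprn_ge0 // ltW.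
  by move=> n; rewrite E.
move=> f; have E (r : R) n : series (fun n => `|f n : R| * r ^+ n) n =
    fnorm (fun x : R => `|x|) n r (sliftY f).
  rewrite /series /= big_mkord; apply: eq_bigr => k _.
  rewrite big_ord_recl /sliftY /= subn0 big1 ?addr0 // => i _.
  by rewrite normr0 mul0r.
split.
  move=> [r r0 /cvgn_bound [M HM]]; exists r, M; split=> // d.
  by apply: le_trans (HM d); rewrite E ler_norm.
move=> [r [M [r0 Ba]]]; exists r => //; apply: (@cvgn_series_bounded _ M).
  by move=> n; rewrite mulr_ge0 ?exprn_ge0 // ltW.
by move=> n; rewrite E.
Qed.

Lemma analytic_field_complex : @analytic_field C R cnorm.
Proof.
split; first exact: absolute_value_cnorm.
  have E (a : series2 C) (r : R) : (fun n => \sum_(i < n.+1) `|a i (n - i)%N| * (r%:C : C) ^+ n) =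
      (fun n => (\sum_(i < n.+1) cnorm (a i (n - i)%N) * r ^+ n)%:C : C).
    apply: funext => n; rewrite rmorph_sum; apply: eq_bigr => i _.
    by rewrite cnormE rmorphM rmorphXn.
  have Es (a : series2 C) (r : R) n :
      series (fun n => \sum_(i < n.+1) cnorm (a i (n - i)%N) * r ^+ n) n =
      fnorm cnorm n r a by rewrite /series /= big_mkord.
  move=> a; split.
    (* A positive element of [R[i]] is real, so the radius can be moved to [R]. *)
    move=> [r r0]; have Er : r = (complex.Re r)%:C by rewrite RRe_real // gtr0_real.
    have r0' : 0 < complex.Re r by rewrite -ltcR -Er.
    rewrite Er E => /cvgn_bound [M HM].
    exists (complex.Re r), (complex.Re M); split=> // d; rewrite -Es.
    have := HM d; rewrite {1}/series /= -rmorph_sum cnormE lecE /= => /andP[_].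
    apply: le_trans; rewrite /cnorm /series /= expr0n addr0 sqrtr_sqr; exact: ler_norm.
  move=> [r [M [r0 Ba]]]; exists r%:C; first by rewrite ltcR.
  rewrite E; apply: cvgn_series_complex; apply: (@cvgn_series_bounded _ M).
    by move=> n; apply: sumr_ge0 => i _; rewrite mulr_ge0 ?exprn_ge0 ?sqrtr_ge0 // ltW.
  by move=> n; rewrite Es.
move=> f; have E (r : R) : (fun n => `|f n| * (r%:C : C) ^+ n) =
    (fun n => (cnorm (f n) * r ^+ n)%:C : C).
  by apply: funext => n; rewrite cnormE rmorphM rmorphXn.
have Es (r : R) n : series (fun n => cnorm (f n) * r ^+ n) n =
    fnorm cnorm n r (sliftY f).
  rewrite /series /= big_mkord; apply: eq_bigr => k _.
  rewrite big_ord_recl /sliftY /= subn0 big1 ?addr0 // => i _.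
  by rewrite (nr0 absolute_value_cnorm) mul0r.
split.
  move=> [r r0]; have Er : r = (complex.Re r)%:C by rewrite RRe_real // gtr0_real.
  have r0' : 0 < complex.Re r by rewrite -ltcR -Er.
  rewrite Er E => /cvgn_bound [M HM].
  exists (complex.Re r), (complex.Re M); split=> // d; rewrite -Es.
  have := HM d; rewrite {1}/series /= -rmorph_sum cnormE lecE /= => /andP[_].
  apply: le_trans; rewrite /cnorm /series /= expr0n addr0 sqrtr_sqr; exact: ler_norm.
move=> [r [M [r0 Ba]]]; exists r%:C; first by rewrite ltcR.
rewrite E; apply: cvgn_series_complex; apply: (@cvgn_series_bounded _ M).
  by move=> n; rewrite mulr_ge0 ?exprn_ge0 ?sqrtr_ge0 // ltW.
by move=> n; rewrite Es.
Qed.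

End ConcreteFields.

(** * Change of coefficients *)

Section MapSeries.
Variables (K L : numFieldType) (phi : {rmorphism K -> L}).
Implicit Types a b p q : fps K.

Definition fmap a : fps L := fun i j => phi (a i j).

Lemma fmapD a b : fmap (a + b) = fmap a + fmap b.
Proof. by apply: fps_ext => i j; rewrite /fmap coefDf rmorphD. Qed.
Lemma fmapM a b : fmap (a * b) = fmap a * fmap b.
Proof.
apply: fps_ext => i j; rewrite /fmap !coefMf rmorph_sum; apply: eq_bigr => m _.
by rewrite rmorph_sum; apply: eq_bigr => n _; rewrite rmorphM.
Qed.
Lemma fmapC c : fmap (fcst c) = fcst (phi c).
Proof. by apply: fps_ext => i j; rewrite /fmap !coefCf; case: ifP; rewrite ?rmorph0. Qed.
Lemma fmap1 : fmap 1 = 1.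
Proof. by rewrite -fcst1 fmapC rmorph1. Qed.
Lemma fmapXn a n : fmap (a ^+ n) = fmap a ^+ n.
Proof. by elim: n => [|n IH]; rewrite ?fmap1 // !exprS fmapM IH. Qed.
Lemma fmap_X : fmap (fX K) = fX L.
Proof. by apply: fps_ext => i j; rewrite /fmap !coefXE rmorph_nat. Qed.
Lemma fmap_Y : fmap (fY K) = fY L.
Proof. by apply: fps_ext => i j; rewrite /fmap !coefYE rmorph_nat. Qed.
Lemma fmap_dX a : fmap (dX a) = dX (fmap a).
Proof. by apply: fps_ext => i j; rewrite /fmap /dX /sderivX rmorphMn. Qed.
Lemma fmap_dY a : fmap (dY a) = dY (fmap a).
Proof. by apply: fps_ext => i j; rewrite /fmap /dY /sderivY rmorphMn. Qed.
Lemma fmap_comp a p q : fmap (fcomp a p q) = fcomp (fmap a) (fmap p) (fmap q).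
Proof.
apply: fps_ext => i j; rewrite {1}/fmap !fcompE rmorph_sum; apply: eq_bigr => m _.
rewrite rmorph_sum; apply: eq_bigr => n _.
by rewrite rmorphM -!fmapXn -fmapM.
Qed.
Lemma fmap_inj a b : fmap a = fmap b -> a = b.
Proof.
move=> E; apply: fps_ext => i j; apply: (fmorph_inj phi).
exact: (congr1 (fun a : fps L => a i j) E).
Qed.
Lemma jac_fmap p q : jac (fmap p) (fmap q) = phi (jac p q).
Proof. by rewrite /jac rmorphB !rmorphM. Qed.

End MapSeries.

(** * Dulac forms with [k = 1]: jets and strong separatrix *)

Section DulacForm.
Variables (K : numFieldType) (R : realType) (nr : K -> R).
Hypothesis afP : analytic_field nr.
Let nrP := af_abs afP.
Variables (mu : K) (N : nat) (h : series2 K).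
Hypothesis N1 : (1 <= N)%N.

Lemma dulac_formE : dulac_form 1 mu N h = VField (fX K ^+ 2 : fps K)
  (fY K + fcst mu * (fX K * fY K) + fX K ^+ (1 + N) * (h : fps K) : fps K).
Proof.
rewrite /dulac_form (smonoE 1 2 0) (smonoE mu 1 1) (smonoE 1 (1 + N) 0).
by rewrite fcst1 !mul1r expr0 !mulr1 !expr1.
Qed.

Lemma prepared_formE (f : series1 K) : prepared_form f = VField (fX K ^+ 2 : fps K)
  (fY K + fX K * (sliftY f : fps K) : fps K).
Proof. by rewrite /prepared_form (smonoE 1 2 0) fcst1 mul1r expr0 mulr1. Qed.

Lemma dulac_coef i j : (i <= 1)%N -> (vfY (dulac_form 1 mu N h)) i j =
  if j == 1%N then (if i == 0%N then 1 else mu) else 0.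
Proof.
move=> Hi; rewrite dulac_formE /= !coefDf coefCM coefXM coefXnM.
rewrite [X in _ + X](_ : _ = 0); last by case: leqP => // L; lia.
by case: i Hi => [|[|i]] // _; case: j => [|[|j]] /=;
  rewrite !coefYE /= ?mulr0 ?mulr1 ?addr0 ?add0r.
Qed.

Lemma analytic_dulac : analytic nr h -> analytic nr (vfY (dulac_form 1 mu N h)).
Proof.
move=> Hh; rewrite dulac_formE /=; apply: (analyticD nrP); last first.
  by apply: (analyticM nrP) => //; apply: (analyticXn nrP); exact: (analyticX nrP).
apply: (analyticD nrP); first exact: (analyticY nrP).
apply: (analyticM nrP); first exact: (analyticC nrP).
by apply: (analyticM nrP); [exact: (analyticX nrP)|exact: (analyticY nrP)].
Qed.

Lemma dulac_conjugate_prepared f :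
  conjugate_to (dulac_form 1 mu N h) (prepared_form f) -> sderiv1 f 0%N = mu.
Proof.
move=> /(conjugateP afP) [P [Q [U [[_ _ P0 Q0 J] [_ _ EP EQ]]]]].
rewrite prepared_formE /= in EP EQ.
have X00 : fX K 0%N 0%N = 0 by rewrite coefXE.
have Y00 : fY K 0%N 0%N = 0 by rewrite coefYE.
have EX : vfX (dulac_form 1 mu N h) = fX K ^+ 2 :> fps K by rewrite dulac_formE.
rewrite fcompXn // fcompX // in EP; rewrite /flie EX in EP EQ.
apply: (@invariant_mu K mu (vfY (dulac_form 1 mu N h)) _ _ _ _ P Q U _ P0 Q0 _ J EP EQ (sliftY f)).
- by rewrite dulac_coef.
- by rewrite dulac_coef.
- by rewrite dulac_coef.
- by rewrite dulac_coef.
- by rewrite coefDf Y00 coef00M X00 mul0r addr0.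
- by apply: fps_ext => i j; rewrite /rowY /sliftY; case: (i == 0%N).
- by [].
Qed.

(** Needed after the real straightening, which by itself says nothing about the eigenvalue in the
    [y] direction. *)
Lemma dulac_conjugate_eigenvalue (b : fps K) : b 0%N 0%N = 0 ->
  conjugate_to (dulac_form 1 mu N h) (VField (fX K ^+ 2 : fps K) b) -> b 0%N 1%N != 0.
Proof.
move=> b0 /(conjugateP afP) [P [Q [U [[_ _ P0 Q0 J] [_ _ EP EQ]]]]].
have X00 : fX K 0%N 0%N = 0 by rewrite coefXE.
have EX : vfX (dulac_form 1 mu N h) = fX K ^+ 2 :> fps K by rewrite dulac_formE.
rewrite /= fcompXn // fcompX // in EP; rewrite /flie EX /= in EP EQ.
have := @invariant_eigenvalue K (vfY (dulac_form 1 mu N h)) _ _ P Q U b P0 Q0 b0 J EP EQ.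
rewrite !dulac_coef //= => /(_ erefl erefl).
by apply: contra_eq_neq => ->; rewrite mulr0 eq_sym oner_neq0.
Qed.

(** The shape of [P] says that it vanishes on the strong separatrix [x = 0], with
    constant transverse derivative. *)
Lemma dulac_separatrix (P U : fps K) : P 0%N 0%N = 0 ->
  flie (dulac_form 1 mu N h) P = U * P ^+ 2 ->
  exists2 S : fps K, P = fX K * (fcst (P 1%N 0%N) + fX K * S) &
    U 0%N 0%N * P 1%N 0%N ^+ 2 = P 1%N 0%N.
Proof.
have EX : vfX (dulac_form 1 mu N h) = fX K ^+ 2 :> fps K by rewrite dulac_formE.
move=> P0; rewrite /flie EX; set d : fps K := vfY (dulac_form 1 mu N h) => EP.
have rd : rowY d = fY K.
  apply: fps_ext => i j; rewrite /rowY coefYE; case: i => [|i] //=.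
  by rewrite /d dulac_coef //=; case: ifP.
have rX : rowY (fX K) = 0 by apply: fps_ext => i j; rewrite /rowY coefXE; case: i.
have Er : fY K * dY (rowY P) = rowY U * (rowY P * rowY P).
  move/(congr1 (@rowY K)): EP.
  by rewrite rowYD !rowYM rX rd -rowY_dY !mul0r add0r.
(* On [x = 0] the equation is [y * P0' = U0 * P0^2]. If [P0] has order at least [n + 1], the right
   side has order at least [2 * n + 2], while [y d/dy] multiplies the coefficient of [y^(n + 1)] by
   [n + 1]; so that coefficient vanishes too. *)
have r0 : forall n, eqd n.+1 (rowY P) 0.
  elim=> [|n IH]; first by move=> [|i] [|j] //; rewrite /rowY /= P0.
  move=> i j L; have [L'|L'] := ltnP (i + j) n.+1; first exact: IH.
  have Eij : (i + j = n.+1)%N by lia.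
  case: i Eij L L' => [|i] // Eij _ _; have -> : j = n.+1 by lia.
  move/(congr1 (fun a : fps K => a 0%N n.+1)): Er.
  rewrite coefYM -[RHS]/((rowY U * (rowY P * rowY P)) 0%N n.+1).
  have Z : eqd (0 + (n.+1 + n.+1)) (rowY U * (rowY P * rowY P)) 0.
    by apply: eqd_M0 => //; apply: eqd_M0.
  rewrite (Z 0%N n.+1); last by lia.
  rewrite /dY /sderivY => /eqP; rewrite -mulr_natl mulf_eq0 pnatr_eq0 /= => /eqP E.
  by rewrite E.
have EP1 : P = fX K * shX P.
  apply: fps_ext => i j; rewrite coefXM /shX; case: i => //.
  have := r0 (0 + j)%N 0%N j (leqnn _); rewrite /rowY /= => ->; by [].
pose P1 := shX P; rewrite -/P1 in EP1.
(* After one division by [x], restriction to [x = 0] leaves [y * P1' = 0]. A second division,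
   evaluated at the origin, gives the other conclusion. *)
have E1 : fX K * (P1 + fX K * dX P1) + d * dY P1 = U * (fX K * P1 ^+ 2).
  apply: (@fX_inj K); move: EP; rewrite EP1 dXX dYX => EP.
  by rewrite [RHS](_ : _ = U * (fX K * P1) ^+ 2); [rewrite -EP; ring|ring].
have r1 : fY K * dY (rowY P1) = 0.
  move/(congr1 (@rowY K)): E1.
  by rewrite rowYD !rowYM rX rd -rowY_dY !(mul0r, mulr0) add0r.
have c1 : P1 = fcst (P 1%N 0%N) + fX K * shX P1.
  apply: fps_ext => i j; rewrite coefDf coefXM coefCf; case: i => [|i]; last by rewrite add0r.
  rewrite addr0 /=; case: j => [|j] //=.
  move/(congr1 (fun a : fps K => a 0%N j.+1)): r1.
  rewrite coefYM /dY /sderivY /rowY /= => /eqP.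
  by rewrite -mulr_natl mulf_eq0 pnatr_eq0 /= => /eqP ->.
exists (shX P1); first by rewrite -c1.
have dP1 : dY P1 = fX K * dY (shX P1) by rewrite {1}c1 dYD dYC add0r dYX.
have E2 : P1 + fX K * dX P1 + d * dY (shX P1) = U * P1 ^+ 2.
  apply: (@fX_inj K); rewrite [RHS](_ : _ = U * (fX K * P1 ^+ 2)); last by ring.
  by rewrite -E1 dP1; ring.
move/(congr1 (fun a : fps K => a 0%N 0%N)): E2.
rewrite !coefDf !coef00M coef00X /d dulac_coef //= coefXE /=.
by rewrite !mul0r !addr0 => <-.
Qed.

End DulacForm.

(** * Descent from complex to real coordinates *)

Section RealReduction.
Variable R : realType.
Local Open Scope complex_scope.
Let C : numFieldType := R[i].
Let iota : {rmorphism R -> C} := real_complex R.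
Let bar : {rmorphism C -> C} := @conjc R.
Let afR := analytic_field_real R.
Let afC := analytic_field_complex R.
Let nrR := af_abs afR.
Let nrC := af_abs afC.

Lemma analytic_iota (a : fps R) : analytic (fun x : R => `|x|) a ->
  analytic (@cnorm R) (fmap iota a).
Proof.
have E x : cnorm (iota x) = `|x| by rewrite /cnorm /= expr0n addr0 sqrtr_sqr.
have Ef d r : fnorm (@cnorm R) d r (fmap iota a) = fnorm (fun x : R => `|x|) d r a.
  by apply: eq_bigr => n _; apply: eq_bigr => i _; rewrite E.
by move=> [r [M [r0 Ba]]]; exists r, M; split=> // d; rewrite Ef.
Qed.

Lemma analytic_Re (a : fps C) : analytic (@cnorm R) a ->
  analytic (fun x : R => `|x|) ((fun i j => complex.Re (a i j)) : fps R).
Proof.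
have L (z : C) : `|complex.Re z| <= cnorm z by rewrite -lecR -cnormE normc_ge_Re.
move=> [r [M [r0 Ba]]]; exists r, M; split=> // d; apply: le_trans (Ba d).
apply: ler_sum => n _; apply: ler_sum => i _.
by apply: ler_wpM2r => //; rewrite exprn_ge0 // ltW.
Qed.

Lemma analytic_bar (a : fps C) : analytic (@cnorm R) a -> analytic (@cnorm R) (fmap bar a).
Proof.
by apply: (analytic_dom nrC) => i j; rewrite -lecR -!cnormE /fmap /= normcJ.
Qed.

Lemma fmap_barK (a : fps C) : fmap bar (fmap bar a) = a.
Proof. by apply: fps_ext => i j; rewrite /fmap /= conjcK. Qed.
Lemma fmap_bar_iota (a : fps R) : fmap bar (fmap iota a) = fmap iota a.
Proof. by apply: fps_ext => i j; rewrite /fmap /= oppr0. Qed.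
Lemma fmap_bar_fixed (a : fps C) : fmap bar a = a ->
  a = fmap iota (fun i j => complex.Re (a i j)).
Proof.
move=> E; apply: fps_ext => i j; rewrite /fmap /=.
move/(congr1 (fun a : fps C => a i j)): E; rewrite /fmap /=; case: (a i j) => x y /= [] E.
have -> : y = 0 by lra.
by [].
Qed.

Lemma complexifyE (X : vfield R) :
  complexify X = VField (fmap iota (vfX X)) (fmap iota (vfY X)).
Proof. by []. Qed.

Lemma conjugate_complexify (X Y : vfield R) :
  conjugate_to X Y -> conjugate_to (complexify X) (complexify Y).
Proof.
move=> /(conjugateP afR) [p [q [u [[Hp Hq p0 q0 J0] [Hu u0 E1 E2]]]]].
apply/(conjugateP afC); exists (fmap iota p), (fmap iota q), (fmap iota u).
have El a : flie (complexify X) (fmap iota a) = fmap iota (flie X a).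
  by rewrite /flie fmapD !fmapM fmap_dX fmap_dY.
split; split.
- exact: analytic_iota.
- exact: analytic_iota.
- by rewrite /fmap p0 rmorph0.
- by rewrite /fmap q0 rmorph0.
- by rewrite jac_fmap fmorph_eq0.
- exact: analytic_iota.
- by rewrite /fmap fmorph_eq0.
- by rewrite El E1 fmapM fmap_comp.
- by rewrite El E2 fmapM fmap_comp.
Qed.

Lemma complexify_prepared (f : series1 R) :
  complexify (prepared_form f) = prepared_form (fun j => iota (f j)).
Proof.
have E : fmap iota (sliftY f) = sliftY (fun j => iota (f j)).
  by apply: fps_ext => i j; rewrite /fmap /sliftY; case: ifP; rewrite ?rmorph0.
by rewrite !prepared_formE complexifyE /= fmapXn fmapD fmapM fmap_X fmap_Y E.
Qed.

(** The strong separatrix [p = 0] of a real vector field is invariant under complex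
    conjugation, so that [c * p] plus its conjugate is a real equation of it, for
    a suitable constant [c]. *)
Lemma real_straightening (X : vfield R) (mu : C) (N : nat) (h : series2 C) :
  singular_germ X -> (1 <= N)%N -> conjugate_to (complexify X) (dulac_form 1 mu N h) ->
  exists b : fps R, [/\ analytic (fun x : R => `|x|) b, b 0%N 0%N = 0 &
    conjugate_to X (VField (fX R ^+ 2 : fps R) b)].
Proof.
move=> [/(af_conv2 afR) HXx /(af_conv2 afR) HXy X00 Y00] N1.
set Xc := complexify X; set D := dulac_form 1 mu N h.
move=> /(conjugateP afC) [p [q [u [[Hp Hq p0 q0 J0] [Hu u0 E1 E2]]]]].
have [s [t [[Hs Ht s0 t0] [J1 C1 C2 C3 C4]]]] := inverse_function nrC Hp Hq p0 q0 J0.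
have ED : vfX D = fX C ^+ 2 :> fps C by rewrite /D dulac_formE.
have fX0 : fX C 0%N 0%N = 0 by rewrite coefXE.
have Lc a := flie_conjugate a p0 q0 E1 E2.
rewrite ED fcompXn // fcompX // in E1.
have Lbar a : flie Xc (fmap bar a) = fmap bar (flie Xc a).
  by rewrite /flie fmapD !fmapM fmap_dX fmap_dY !fmap_bar_iota.
pose ub := fmap bar u; pose pb := fmap bar p.
have E3 : flie Xc pb = ub * pb ^+ 2 by rewrite Lbar E1 fmapM fmapXn.
have compK a : fcomp (fcomp a s t) p q = a by rewrite fcompA // C3 C4 fcomp_id.
have compK' a : fcomp (fcomp a p q) s t = a by rewrite fcompA // C1 C2 fcomp_id.
(* The conjugate equation is read in Dulac's coordinates, where [dulac_separatrix] shows it to be a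
   multiple of the first coordinate. *)
pose P := fcomp pb s t; pose U := fcomp (finv u * ub) s t.
have pb0 : pb 0%N 0%N = 0 by rewrite /pb /fmap p0 rmorph0.
have P0 : P 0%N 0%N = 0 by rewrite /P coef00_comp.
have E4 : flie D P = U * P ^+ 2.
  have : u * fcomp (flie D P) p q = ub * pb ^+ 2 by rewrite -Lc /P compK.
  move=> E; rewrite -[LHS]compK' /U /P -fcompXn // -fcompM //; congr fcomp.
  by rewrite -mulrA -E mulrA [finv u * u]mulrC finvP // mul1r.
have [S EP al1] := dulac_separatrix N1 P0 E4.
set al := P 1%N 0%N in EP al1.
pose v : fps C := fcst al + p * fcomp S p q.
have Epb : pb = p * v.
  by rewrite -[LHS]compK -/P EP fcompXM // fcompD fcompC fcompXM.
(* If [al] vanished, [pb = p * v] would have no linear part, and neither would its conjugate [p]. *)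
have al0 : al != 0.
  apply: contraTneq J0 => al0; rewrite negbK.
  have -> : jac p q = bar (jac pb (fmap bar q)) by rewrite jac_fmap /= conjcK.
  rewrite fmorph_eq0 /jac Epb /v coef10M coef01M p0 !coefDf coefCf /= al0 coef00M p0.
  by rewrite !(mul0r, mulr0, addr0) subrr.
have v0 : v 0%N 0%N = al by rewrite /v coefDf coefCf coef00M p0 mul0r addr0.
have al2 : ub 0%N 0%N * al = u 0%N 0%N.
  move: al1; rewrite /U coef00_comp coef00M coef00_finv // expr2 => E.
  have E' : (u 0%N 0%N)^-1 * ub 0%N 0%N * al = 1.
    by apply: (mulIf al0); rewrite mul1r -[RHS]E mulrA.
  by rewrite -[RHS]mulr1 -E' !mulrA mulfV // mul1r.
(* [c = 1] works unless [al = - 1], in which case [c = i] gives [2 * i]. *)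
have [c e0] : exists c : C, c + bar c * al != 0.
  have [E|E] := eqVneq (1 + al) 0; last by exists 1; rewrite rmorph1 mul1r.
  exists ('i%C : C); have -> : al = - 1 by apply/eqP; rewrite -addr_eq0 addrC E.
  by rewrite eq_complex /= negb_and; apply/orP; right; simpc; rewrite /=; lra.
pose e : fps C := fcst c + fcst (bar c) * v.
have ee0 : e 0%N 0%N != 0 by rewrite /e coefDf coefCM coefCf v0.
pose Pc : fps C := fcst c * p + fcst (bar c) * pb.
have EPc : Pc = p * e by rewrite /Pc Epb /e; ring.
have barPc : fmap bar Pc = Pc.
  by rewrite /Pc fmapD !fmapM !fmapC fmap_barK /= conjcK -/pb addrC.
(* The derivative of [Pc] is [c * u * p^2] plus [bar c * ub * pb^2]; substitute [pb = p * v] and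
   [p = Pc / e]. *)
pose W : fps C := (fcst c * u + fcst (bar c) * (ub * v ^+ 2)) * finv e ^+ 2.
have LC z a : flie Xc (fcst z * a) = fcst z * flie Xc a.
  by rewrite /flie dXCM dYCM; ring.
have LD a a' : flie Xc (a + a') = flie Xc a + flie Xc a'.
  by rewrite /flie dXD dYD; ring.
have EW : flie Xc Pc = W * Pc ^+ 2.
  rewrite /Pc LD !LC E1 E3 -/Pc EPc Epb /W.
  transitivity ((fcst c * u + fcst (bar c) * (ub * v ^+ 2)) * p ^+ 2 * (e * finv e) ^+ 2).
    by rewrite finvP // expr1n; ring.
  by ring.
(* By [al2] the numerator is [u(0) * (c + bar c * al)] at the origin, so the choice of [c] serves a
   second time. *)
have W0 : W 0%N 0%N != 0.
  rewrite /W coef00M coefDf !coefCM coef00M !coef00X v0 coef00_finv //.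
  have -> : ub 0%N 0%N * al ^+ 2 = u 0%N 0%N * al by rewrite -al2 expr2 mulrA.
  rewrite (_ : _ + _ = u 0%N 0%N * (c + bar c * al)); last by ring.
  apply: mulf_neq0; first exact: mulf_neq0.
  by apply: expf_neq0; rewrite invr_eq0.
have p_reg a : p * a = 0 -> a = 0.
  move=> E; rewrite -[LHS]compK; have -> : fcomp a s t = 0; last exact: fcomp0.
  by apply: (@fX_inj C); rewrite mulr0 -{1}C1 -fcompM // E fcomp0.
(* The field and [Pc] are real, so [Pc^2] annihilates [bar W - W]; it can be cancelled because [p],
   being a coordinate, is not a zero divisor. *)
have barW : fmap bar W = W.
  have : Pc ^+ 2 * (fmap bar W - W) = 0.
    rewrite mulrBr [_ * W]mulrC -EW -{1}barPc -fmapXn mulrC -fmapM -EW -Lbar barPc.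
    by rewrite subrr.
  rewrite EPc => E; apply/eqP; rewrite -subr_eq0; apply/eqP.
  apply/p_reg/p_reg.
  transitivity ((p * e) ^+ 2 * (fmap bar W - W) * (finv e) ^+ 2); last by rewrite E mul0r.
  transitivity (p * (p * (fmap bar W - W)) * (e * finv e) ^+ 2); last by ring.
  by rewrite finvP // expr1n mulr1.
have Hub : analytic (@cnorm R) ub := analytic_bar Hu.
have Hpb : analytic (@cnorm R) pb := analytic_bar Hp.
have HCc z : analytic (@cnorm R) (fcst z) by apply: (analyticC nrC).
have Hv : analytic (@cnorm R) v.
  have HS : analytic (@cnorm R) (shX (shX P)).
    by do 2!apply: (analytic_shX nrC); exact: (analytic_comp nrC).
  have -> : v = fcst al + p * fcomp (shX (shX P)) p q.
    rewrite /v; congr (_ + _ * fcomp _ _ _); apply: fps_ext => i j.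
    by rewrite /shX {1}EP coefXM coefDf coefXM coefCf /= add0r.
  by apply: (analyticD nrC) => //; apply: (analyticM nrC) => //; exact: (analytic_comp nrC).
have He : analytic (@cnorm R) e by apply: (analyticD nrC) => //; exact: (analyticM nrC).
have HPc : analytic (@cnorm R) Pc by apply: (analyticD nrC); exact: (analyticM nrC).
have HW : analytic (@cnorm R) W.
  apply: (analyticM nrC); last by apply: (analyticXn nrC); exact: (analytic_finv nrC).
  apply: (analyticD nrC); first exact: (analyticM nrC).
  by do 2?apply: (analyticM nrC) => //; exact: (analyticXn nrC).
pose Pr : fps R := fun i j => complex.Re (Pc i j).
pose Wr : fps R := fun i j => complex.Re (W i j).
have EPr : Pc = fmap iota Pr by exact: fmap_bar_fixed.
have EWr : W = fmap iota Wr by exact: fmap_bar_fixed.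
have HPr := analytic_Re HPc; rewrite -/Pr in HPr.
have HWr := analytic_Re HW; rewrite -/Wr in HWr.
have Pr0 : Pr 0%N 0%N = 0 by rewrite /Pr EPc coef00M p0 mul0r.
have Wr0 : Wr 0%N 0%N != 0 by move: W0; rewrite EWr /fmap fmorph_eq0.
have ELr : flie X Pr = Wr * Pr ^+ 2.
  apply: (@fmap_inj _ _ iota); move: EW; rewrite EPr EWr -fmapXn -fmapM => <-.
  by rewrite /flie fmapD !fmapM fmap_dX fmap_dY.
(* [Pr] has a nonzero linear part, like [p], so [y] or [x] completes it to real coordinates. *)
have [Qr [HQr Qr0 Jr]] : exists Qr : fps R,
    [/\ analytic (fun x : R => `|x|) Qr, Qr 0%N 0%N = 0 & jac Pr Qr != 0].
  have [E10|E10] := eqVneq (Pr 1%N 0%N) 0; last first.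
    exists (fY R); split; [exact: (analyticY nrR)|by rewrite coefYE|].
    by rewrite /jac !coefYE /= mulr1 mulr0 subr0.
  exists (fX R); split; [exact: (analyticX nrR)|by rewrite coefXE|].
  rewrite /jac !coefXE /= mulr1 mulr0 sub0r oppr_eq0.
  have nz i j : (p * e) i j = iota (Pr i j) by rewrite -EPc EPr.
  apply: contraTneq J0 => E01; rewrite negbK /jac.
  have p10 : p 1%N 0%N = 0.
    apply: (mulIf ee0); rewrite mul0r; have := nz 1%N 0%N.
    by rewrite coef10M p0 mul0r addr0 E10 rmorph0.
  have p01 : p 0%N 1%N = 0.
    apply: (mulIf ee0); rewrite mul0r; have := nz 0%N 1%N.
    by rewrite coef01M p0 mul0r addr0 E01 rmorph0.
  by rewrite p10 p01 !mul0r subrr.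
have [sr [tr [[Hsr Htr sr0 tr0] [_ _ _ D3 D4]]]] := inverse_function nrR HPr HQr Pr0 Qr0 Jr.
exists (fcomp (finv Wr * flie X Qr) sr tr).
have HL : analytic (fun x : R => `|x|) (finv Wr * flie X Qr).
  apply: (analyticM nrR); first exact: (analytic_finv nrR).
  apply: (analyticD nrR); apply: (analyticM nrR) => //.
    exact: (analytic_dX nrR).
  exact: (analytic_dY nrR).
split.
- exact: (analytic_comp nrR).
- rewrite coef00_comp coef00M /flie coefDf !coef00M.
  have -> : (vfX X : fps R) 0%N 0%N = 0 by exact: X00.
  have -> : (vfY X : fps R) 0%N 0%N = 0 by exact: Y00.
  by rewrite !mul0r addr0 mulr0.
apply/(conjugateP afR); exists Pr, Qr, Wr; split; split=> //.
- by rewrite /= fcompXn // fcompX.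
- by rewrite /= fcompA // D3 D4 fcomp_id mulrA finvP // mul1r.
Qed.

End RealReduction.

Theorem theorem1 (R : realType) :
  (forall (X : vfield R) (mu : R[i]),
     singular_germ X -> saddle_node X ->
     formal_invariants (complexify X) 1 mu ->
     exists f : series1 R,
       [/\ convergent1 f, (sderiv1 f 0%N)%:C%C = mu &
           conjugate_to X (prepared_form f)])
  /\
  (forall (X : vfield R[i]) (mu : R[i]),
     singular_germ X -> saddle_node X ->
     formal_invariants X 1 mu ->
     exists f : series1 R[i],
       [/\ convergent1 f, sderiv1 f 0%N = mu &
           conjugate_to X (prepared_form f)]).
Proof.
have afR := analytic_field_real R; have afC := analytic_field_complex R.
(* [N >= 1] pushes the remainder of the Dulac form to order two in [x], out of reach of the
   coefficients of [y] and [x * y]. *)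
split=> X mu sX _ [_ /(_ 1%N) [N [h [N1 Hh cX]]]].
  have [b [Hb b0 cb]] := real_straightening sX N1 cX.
  have cXb := conjugate_complexify cb.
  have cD := conjugate_trans afC (conjugate_sym afC cX) cXb.
  have Ec : complexify (VField (fX R ^+ 2 : fps R) b) =
      VField (fX _ ^+ 2 : fps R[i]) (fmap (real_complex R) b).
    by rewrite complexifyE /= fmapXn fmap_X.
  rewrite Ec in cD.
  have b01 : b 0%N 1%N != 0.
    have : (fmap (real_complex R) b) 0%N 1%N != 0.
      by apply: (dulac_conjugate_eigenvalue afC N1 _ cD); rewrite /fmap b0 rmorph0.
    by rewrite /fmap fmorph_eq0.
  have [f [Hf cf]] := preparation afR Hb b0 b01.
  have cXf := conjugate_trans afR cb cf.
  exists f; split=> //.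
  (* [mu] is given as a complex number; comparing the Dulac form with the complexified prepared form
     shows that it is the real number [f'(0)]. *)
  have := conjugate_trans afC (conjugate_sym afC cX) (conjugate_complexify cXf).
  rewrite complexify_prepared => /(dulac_conjugate_prepared afC N1) <-.
  by rewrite /sderiv1 !mulr1n.
have Ed := dulac_formE mu N h.
have [|| f [Hf cf]] := preparation afC (analytic_dulac afC mu N (proj1 (af_conv2 afC _) Hh)).
- by rewrite dulac_coef.
- by rewrite dulac_coef //= oner_neq0.
have cDf : conjugate_to (dulac_form 1 mu N h) (prepared_form f).
  by move: cf; rewrite Ed.
exists f; split=> //; first exact: (dulac_conjugate_prepared afC N1 cDf).
exact: (conjugate_trans afC cX cDf).
Qed.
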